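(* For every $0<\varepsilon<1/2$ there exist real numbers $k_\varepsilon, K_\varepsilon$ such that the following holds. For every prime $p$ with $\log p > k_\varepsilon + K_\varepsilon$ and every $\mathbb{F}_p$-valued random variable $X$ satisfying $$k_\varepsilon < H(X) < \log p - K_\varepsilon,$$ we have $$H(X+X') \ge H(X) + \frac12 - \varepsilon,$$ where $X'$ is an independent copy of $X$.
   Context: All logarithms are to base $2$. For a discrete random variable $X$, $H(X) = -\sum_x \Pr(X=x)\log \Pr(X=x)$ is its Shannon entropy (with $0\log 0 = 0$). An independent copy of $X$ is a random variable independent of $X$ with the same distribution. *)

(* Defs.v *)
From HB Require Import structures.
From mathcomp Require Import all_boot all_order all_algebra.
From mathcomp Require Import all_classical all_reals all_analysis.

Set Implicit Arguments.
Unset Strict Implicit.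
Unset Printing Implicit Defensive.

Import Order.TTheory GRing.Theory Num.Theory.

Local Open Scope classical_set_scope.
Local Open Scope ring_scope.

(* Finite ordinals, hence also the prime fields ['F_p], carry the discrete
   sigma-algebra, so that [{RV P >-> 'F_p}] is meaningful. *)
HB.instance Definition _ (n : nat) := isPointed.Build 'I_n.+1 ord0.

HB.instance Definition _ (n : nat) :=
  @isMeasurable.Build default_measure_display 'I_n.+1 discrete_measurable
    discrete_measurable0 discrete_measurableC discrete_measurableU.

Definition log2 (R : realType) (x : R) : R := ln x / ln 2.

(* [Pr] is the analogue of the library's [pmf], which is restricted to
   real-valued random variables. *)
Definition Pr (d : measure_display) (T : measurableType d) (R : realType)
    (P : probability T R) (A : Type) (X : T -> A) (x : A) : R :=
  fine (P (X @^-1` [set x])).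

(* The convention [0 log 0 = 0] holds because of the factor 0. *)
Definition entropy (d : measure_display) (T : measurableType d) (R : realType)
    (P : probability T R) (A : finType) (X : T -> A) : R :=
  - \sum_(x : A) Pr P X x * log2 (Pr P X x).

Definition independent_RV (d d1 d2 : measure_display) (T : measurableType d)
    (T1 : measurableType d1) (T2 : measurableType d2) (R : realType)
    (P : probability T R) (X : {RV P >-> T1}) (Y : {RV P >-> T2}) : Prop :=
  forall (A : set T1) (B : set T2), measurable A -> measurable B ->
    P (X @^-1` A `&` Y @^-1` B) = (P (X @^-1` A) * P (Y @^-1` B))%E.

Definition identically_distributed (d d' : measure_display)
    (T : measurableType d) (T' : measurableType d') (R : realType)
    (P : probability T R) (X Y : {RV P >-> T'}) : Prop :=
  forall A : set T', measurable A -> distribution P X A = distribution P Y A.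

Definition independent_copy (d d' : measure_display) (T : measurableType d)
    (T' : measurableType d') (R : realType) (P : probability T R)
    (X X' : {RV P >-> T'}) : Prop :=
  independent_RV X X' /\ identically_distributed X X'.

(* Main.v *)
Require Import Defs.
From HB Require Import structures.
From mathcomp Require Import all_boot all_order all_algebra.
From mathcomp Require Import all_classical all_reals all_analysis.
From mathcomp Require Import zify lra ring.

(* Let f be the law of X on 'F_p. If f is carried by at most p/2 points,
   Pollard's theorem applied to pairs of level sets of f shows that f * f is
   majorized by the law of Y + Y', where Y has the symmetric decreasing
   rearrangement of f as density on the line; Schur concavity then reduces the
   theorem, up to an error O(max f), to h(Y + Y') >= h(Y) + 1/2. For this,
   transport a discrete Gaussian (i, j) to (Y, Y') by monotone rearrangement:
   for a fixed difference i - j, the sums of the cells of i and j tile the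
   line, so any density of Y + Y' has mass at most 1 on each diagonal. With
   AM-GM for the cell lengths, Jensen's inequality gives
   h(Y + Y') >= h(Y) + log 2 - log (Z(beta / 2) / Z(beta)), where Z is the
   Gaussian partition function, and the last ratio is close to sqrt 2 for a
   suitable small beta.
   In general a large atom makes H(X + X') - H(X) large by concavity of the
   entropy, and otherwise the values of f outside its top p/2 points form an
   almost uniform law, which can only increase the gain when H(X) is far from
   log p. *)

Set Implicit Arguments.
Unset Strict Implicit.
Unset Printing Implicit Defensive.

Import Order.TTheory GRing.Theory Num.Theory numFieldNormedType.Exports.

(** * Pollard's theorem *)

Section Pollard.
Variables (p : nat) (p_pr : prime p).
Implicit Types A B : {set 'F_p}.

Definition rep A B (x : 'F_p) : nat := \sum_(y in A) (x - y \in B)%R.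

Lemma sum_rep A B : \sum_x rep A B x = #|A| * #|B|.
Proof.
rewrite exchange_big /= -sum_nat_const; apply: eq_bigr => y _.
rewrite (reindex_inj (addIr y)) /= -sum1_card [RHS]big_mkcond /=.
by apply: eq_bigr => x _; rewrite addrK; case: (_ \in B).
Qed.

Lemma rep_leq A B x : rep A B x <= #|B|.
Proof.
rewrite /rep -sum1_card big_mkcond /= [leqRHS](reindex_inj (subrI x)) /=.
rewrite [leqRHS]big_mkcond /=; apply: leq_sum => y _.
by case: (y \in A) => //; case: (_ \in B).
Qed.

Lemma rep_shift A B g x : rep A [set y + g | y in B]%R x = rep A B (x - g)%R.
Proof.
apply: eq_bigr => y _; congr (nat_of_bool _).
apply/imsetP/idP => [[z zB e]|h]; last by exists (x - g - y)%R => //; ring.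
by have -> : (x - g - y = z)%R by rewrite -[z](addrK g) -e; ring.
Qed.

(** Flip by y -> x - y the pairs in [A :&: B] times [B :\: A]: together with the pairs in A times
    [A :&: B] they fill [A :|: B] times [A :&: B]. *)
Lemma rep_setUI A B x :
  rep A B x = rep (A :|: B) (A :&: B) x + rep (A :\: B) (B :\: A) x.
Proof.
have flip (U V : {set _}) : \sum_y ((y \in U) && (x - y \in V)%R) =
                 \sum_y ((y \in V) && (x - y \in U)%R).
  rewrite (reindex_inj (subrI x)) /=; apply: eq_bigr => y _.
  by rewrite subKr andbC.
have repE U V : rep U V x = \sum_y ((y \in U) && (x - y \in V)%R).
  by rewrite /rep big_mkcond /=; apply: eq_bigr => y _; case: (y \in U).
rewrite !repE.
have -> : \sum_y ((y \in A) && (x - y \in B)%R) =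
   \sum_y ((y \in A) && (x - y \in A :&: B)%R) +
   (\sum_y ((y \in A :&: B) && (x - y \in B :\: A)%R) +
   \sum_y ((y \in A :\: B) && (x - y \in B :\: A)%R)).
  rewrite -!big_split /=; apply: eq_bigr => y _; rewrite !inE.
  by case: (y \in A); case: (y \in B); case: (_ \in A); case: (_ \in B).
rewrite (flip (A :&: B)) addnA -!big_split /=; apply: eq_bigr => y _; rewrite !inE.
by case: (y \in A); case: (y \in B); case: (_ \in A); case: (_ \in B).
Qed.

Lemma addr_closed_setT A (a d : 'F_p) : d != 0%R -> a \in A ->
  (forall x, x \in A -> x + d \in A)%R -> A = [set: 'F_p].
Proof.
move=> d0 aA clA; apply/finset.setP => x; rewrite inE.
have h (n : nat) : (a + d *+ n \in A)%R.
  elim: n => [|n ih]; first by rewrite mulr0n addr0.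
  by rewrite mulrSr addrA; apply: clA.
have -> : (x = a + d *+ (nat_of_ord ((x - a) / d)))%R; last exact: h.
by rewrite -mulr_natr natr_Zp mulrC divfK // addrC subrK.
Qed.

(** If every translate of B meeting A were contained in A, then A would be stable under adding the
    difference of two elements of B, hence all of 'F_p. *)
Lemma exists_shift A B : A != finset.set0 -> 1 < #|B| -> #|A| < p ->
  exists g : 'F_p, (0 < #|A :&: [set y + g | y in B]%R| < #|B|).
Proof.
move=> /set0Pn[a aA] /card_gt1P[b1 [b2 [b1B b2B b12]]] Ap.
have [/existsP[g /andP[]]|] := boolP [exists g : 'F_p,
   (A :&: [set y + g | y in B]%R != finset.set0) && ~~ ([set y + g | y in B]%R \subset A)].
  rewrite -card_gt0 => h1 h2; exists g; rewrite h1 /=.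
  rewrite -[ltnRHS](card_imset _ (addIr g)) proper_card //.
  rewrite finset.properEneq finset.subsetIr andbT; apply: contra h2 => /eqP <-.
  exact: finset.subsetIl.
rewrite negb_exists => /forallP H; exfalso.
suff : A = [set: 'F_p] by move=> E; move: Ap; rewrite E cardsT card_Fp // ltnn.
apply: (@addr_closed_setT _ a (b2 - b1)%R) => //; first by rewrite subr_eq0 eq_sym.
move=> x xA; have := H (x - b1)%R; rewrite negb_and !negbK => /orP[/eqP E|/fintype.subsetP E].
  have : x \in A :&: [set y + (x - b1) | y in B]%R.
    by rewrite inE xA; apply/imsetP; exists b1 => //; rewrite addrC subrK.
  by rewrite E inE.
by apply: E; apply/imsetP; exists b2 => //; ring.
Qed.

(* Induction on #|B|: once B is translated so that it meets A without being
   contained in it, rep_setUI replaces (A, B) by (A :|: B, A :&: B), with the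
   remainder (A :\: B, B :\: A) when t exceeds #|A :&: B|. *)
Lemma pollard A B t : #|A| + #|B| <= p -> t <= #|A| -> t <= #|B| ->
  t * (#|A| + #|B| - t) <= \sum_x minn t (rep A B x).
Proof.
move: {2}#|B|.+1 (ltnSn #|B|) => n; elim: n => // n IH in A B t *.
move=> ltBn leABp tA; rewrite leq_eqVlt => /orP[/eqP tB|tB].
  rewrite tB addnK mulnC -sum_rep leq_eqVlt; apply/orP; left; apply/eqP.
  by apply: eq_bigr => x _; rewrite (minn_idPr _) // rep_leq.
have [->|t0] := posnP t; first by rewrite mul0n.
have A0 : A != finset.set0 by rewrite -card_gt0; lia.
have [||g /andP[I0 IB]] := exists_shift A0 (B := B); [lia..|].
set B' : {set 'F_p} := [set y + g | y in B]%R in I0 IB.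
have cB' : #|B'| = #|B| by rewrite card_imset //; apply: addIr.
rewrite (reindex_inj (addIr (- g))%R) /=.
under eq_bigr do rewrite -rep_shift -/B' rep_setUI.
have := cardsUI A B'; have := cardsID B' A; have := cardsID A B'.
rewrite [B' :&: A]finset.setIC cB' => cD' cD cU.
set s := #|A :&: B'| in I0 IB cD cD' cU.
have E : #|A| + #|B| = #|A :|: B'| + s by lia.
rewrite E.
have [ts|st] := leqP t s.
  apply: leq_trans (_ : \sum_x minn t (rep (A :|: B') (A :&: B') x) <= _).
    by apply: IH; rewrite -/s; lia.
  by apply: leq_sum => x _; rewrite leq_min geq_minl /= (leq_trans (geq_minr _ _)) ?leq_addr.
(* The first summand never exceeds s, so a truncation at t leaves at least t - s for the remainder
   pair. *)
have H : (t - s) * (#|A :\: B'| + #|B' :\: A| - (t - s)) <=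
   \sum_x minn (t - s) (rep (A :\: B') (B' :\: A) x).
  by apply: IH; lia.
apply: leq_trans (_ : \sum_x (rep (A :|: B') (A :&: B') x +
     minn (t - s) (rep (A :\: B') (B' :\: A) x)) <= _).
  rewrite big_split /= sum_rep -/s; apply: leq_trans (leq_add (leqnn _) H).
  have [w tE] : exists w, t = s + w by exists (t - s); lia.
  have [z UE] : exists z, #|A :|: B'| = s + w + z by exists (#|A :|: B'| - t); lia.
  have -> : #|A :\: B'| + #|B' :\: A| - (t - s) = z by lia.
  (* Both sides agree: s (s + w + z) + w z = (s + w) (s + z). *)
  by rewrite UE tE; nia.
apply: leq_sum => x _; have := rep_leq (A :|: B') (A :&: B') x; rewrite -/s.
by lia.
Qed.

End Pollard.

(** * Clamping to a symmetric interval *)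

Local Open Scope ring_scope.

Section Clamp.
Variable R : realType.
Implicit Types (c x y z : R).

Definition clamp c z : R := Num.max (- c) (Num.min c z).

Lemma clamp_mono c x y : x <= y -> clamp c x <= clamp c y.
Proof. by move=> xy; rewrite /clamp le_max2 // le_min2. Qed.

Lemma clamp_ge c z : - c <= clamp c z. Proof. by rewrite /clamp le_max lexx. Qed.

Lemma clamp_le c z : 0 <= c -> clamp c z <= c.
Proof. by move=> c0; rewrite /clamp ge_max ge_min lexx /= andbT; lra. Qed.

Lemma clamp_id c z : - c <= z -> z <= c -> clamp c z = z.
Proof. by move=> h1 h2; rewrite /clamp (min_idPr h2) (max_idPr h1). Qed.

Lemma clamp_big c z : 0 <= c -> c <= z -> clamp c z = c.
Proof. by move=> h1 h2; rewrite /clamp (min_idPl h2) (max_idPr _) //; lra. Qed.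

Lemma clamp_small c z : 0 <= c -> z <= - c -> clamp c z = - c.
Proof.
by move=> h1 h2; rewrite /clamp (min_idPr _) ?(max_idPl _) //; lra.
Qed.

Lemma clampP c z : 0 <= c ->
  (z <= - c /\ clamp c z = - c) \/ [/\ - c <= z, z <= c & clamp c z = z] \/
  (c <= z /\ clamp c z = c).
Proof.
move=> c0; case: (leP z (- c)) => h1; first by left; rewrite clamp_small.
case: (leP z c) => h2; last by right; right; rewrite clamp_big // ltW.
by right; left; rewrite clamp_id ?(ltW h1).
Qed.

Lemma clamp0 z : clamp 0 z = 0.
Proof. by case: (clampP z (lexx 0)) => [[? ->]|[[? ? ->]|[? ->]]]; lra. Qed.

Lemma clampN c z : 0 <= c -> clamp c (- z) = - clamp c z.
Proof.
move=> c0; case: (clampP z c0) => [[? ->]|[[? ? ->]|[? ->]]];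
  case: (clampP (- z) c0) => [[? ->]|[[? ? ->]|[? ->]]]; lra.
Qed.

(** A clamped increment is the length of the part of [x, y] inside [-c, c], which grows with c. *)
Lemma clamp_diff c c' x y : 0 <= c -> c <= c' -> x <= y ->
  clamp c y - clamp c x <= clamp c' y - clamp c' x.
Proof.
move=> c0 cc xy; have c'0 : 0 <= c' by lra.
case: (clampP x c0) => [[? ->]|[[? ? ->]|[? ->]]];
  case: (clampP y c0) => [[? ->]|[[? ? ->]|[? ->]]];
  case: (clampP x c'0) => [[? ->]|[[? ? ->]|[? ->]]];
  case: (clampP y c'0) => [[? ->]|[[? ? ->]|[? ->]]]; lra.
Qed.

Lemma clamp_continuous c : continuous (clamp c).
Proof.
move=> x; apply: (@continuous_max _ _ (cst (- c)) (fun z => Num.min c z)).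
  exact: cvg_cst.
by apply: (@continuous_min _ _ (cst c) id); [exact: cvg_cst | exact: cvg_id].
Qed.

End Clamp.

Lemma telescope_nat (V : zmodType) (f : nat -> V) n :
  \sum_(i < n) (f i.+1 - f i) = f n - f 0%N.
Proof. by rewrite -(big_mkord xpredT (fun i => f i.+1 - f i)) telescope_sumr. Qed.

(** * Strips and rectangles *)

Section Triangle.
Variable R : realType.
Implicit Types (a b c u x y z : R) (t : nat -> R).

Definition pos x : R := Num.max 0 x.

Lemma posP x : (x <= 0 /\ pos x = 0) \/ (0 <= x /\ pos x = x).
Proof.
rewrite /pos; case: (leP x 0) => h; first by left.
by right; rewrite ltW.
Qed.

(** Length of the part of the interval [t i, t i.+1] inside [-a, a]. *)
Definition cell a t i : R := clamp a (t i.+1) - clamp a (t i).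

Lemma cell_ge0 a t i : (forall k, t k <= t k.+1) -> 0 <= cell a t i.
Proof. by move=> tm; rewrite subr_ge0 clamp_mono. Qed.

(** The cells counted are disjoint and lie to the right of u, so their clamped parts fit between u
    and b; [psi] makes this telescope. *)
Lemma cell_above b t u N : 0 <= b -> (forall k, t k <= t k.+1) ->
  \sum_(j < N) cell b t j * (u < t j)%R%:R <= pos (b - u).
Proof.
move=> b0 tm; pose psi j := Num.max u (clamp b (t j)).
apply: (@le_trans _ _ (\sum_(j < N) (psi j.+1 - psi j))).
  apply: ler_sum => j _; rewrite /cell /psi.
  have m := clamp_mono b (tm j).
  have [ut|tu] := ltP u (t j); last by rewrite mulr0 subr_ge0 le_max2.
  rewrite mulr1; have [|h1] := leP (clamp b (t j)) u.
    move=> h1; have tb : b <= t j.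
      case: (clampP (t j) b0) => [[? e]|[[? ? e]|[? e]]] //; last by lra.
      by have := clamp_ge b (t j); lra.
    rewrite (clamp_big b0 tb) clamp_big // ?(le_trans tb) //.
    by rewrite subrr subr_ge0 le_max lexx.
  by rewrite lerB // le_max lexx orbT.
rewrite telescope_nat /psi.
have h1 : u <= Num.max u (clamp b (t 0%N)) by rewrite le_max lexx.
have h2 : Num.max u (clamp b (t N)) <= Num.max u b by rewrite le_max2 // clamp_le.
have h3 : Num.max u b - u <= pos (b - u).
  by case: (leP u b) => h; case: (posP (b - u)) => [[? ->]|[? ->]]; lra.
lra.
Qed.

Lemma pos_convex x y : x <= y -> (y - x) * pos x <= (pos y ^+ 2 - pos x ^+ 2) / 2.
Proof.
move=> xy; case: (posP x) => [[? ->]|[? ->]]; case: (posP y) => [[? ->]|[? ->]];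
  rewrite ?expr2; nra.
Qed.

(** Rectangles of cells beyond the line x + y = c fit into a corner of [-a, a] x [-b, b]; the bound
    is the integral of pos (b - c + x) over [-a, a], estimated on each cell from its left end. *)
Lemma upper_triangle a b c t N : 0 <= a -> 0 <= b -> (forall k, t k <= t k.+1) ->
  \sum_(i < N) \sum_(j < N) cell a t i * cell b t j * (c < t i + t j)%R%:R <=
  (pos (a + b - c) ^+ 2 - pos (b - c - a) ^+ 2) / 2.
Proof.
move=> a0 b0 tm; pose psi i := pos (b - c + clamp a (t i)) ^+ 2 / 2.
apply: (@le_trans _ _ (\sum_(i < N) (psi i.+1 - psi i))); last first.
  rewrite telescope_nat /psi.
  have h1 := clamp_ge a (t 0%N); have h2 := clamp_le (t N) a0.
  have mono x y : x <= y -> pos x ^+ 2 <= pos y ^+ 2.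
    move=> xy; rewrite !expr2.
    by case: (posP x) => [[? ->]|[? ->]]; case: (posP y) => [[? ->]|[? ->]]; nra.
  have := mono (b - c + clamp a (t N)) (a + b - c).
  have := mono (b - c - a) (b - c + clamp a (t 0%N)).
  by move=> /(_ ltac:(lra)) + /(_ ltac:(lra)); lra.
apply: ler_sum => i _.
have al0 := cell_ge0 a i tm.
apply: (@le_trans _ _ (cell a t i * pos (b - (c - t i)))).
  apply: le_trans (ler_wpM2l al0 (cell_above (c - t i) N b0 tm)).
  rewrite mulr_sumr; apply: ler_sum => j _.
  by rewrite mulrA ltrBlDl.
have m := clamp_mono a (tm i).
have h := @pos_convex (b - c + clamp a (t i)) (b - c + clamp a (t i.+1)).
rewrite /psi -mulrBl; apply: le_trans (h _); last by lra.
have -> : b - c + clamp a (t i.+1) - (b - c + clamp a (t i)) = cell a t i.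
  by rewrite /cell; lra.
have [ta|at_] := leP (t i) a.
  apply: ler_wpM2l => //.
  have : t i <= clamp a (t i) by rewrite /clamp (min_idPr ta) le_max lexx orbT.
  rewrite /pos => ?; rewrite le_max2 //; lra.
have -> : cell a t i = 0.
  by rewrite /cell !clamp_big ?subrr // ?(ltW at_) // (le_trans (ltW at_)).
by rewrite !mul0r.
Qed.

(** The reflection z -> - z turns this into [upper_triangle]; the reversed sequence is frozen after
    N so that it stays monotone. *)
Lemma lower_triangle a b c t N : 0 <= a -> 0 <= b -> (forall k, t k <= t k.+1) ->
  \sum_(i < N) \sum_(j < N) cell a t i * cell b t j * (t i.+1 + t j.+1 < - c)%R%:R <=
  (pos (a + b - c) ^+ 2 - pos (b - c - a) ^+ 2) / 2.
Proof.
move=> a0 b0 tm; pose t' (k : nat) := if (k <= N)%N then - t (N - k)%N else - t 0%N.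
have tm' k : t' k <= t' k.+1.
  rewrite /t'; have [kN|Nk|->] := ltngtP k N; last 2 first.
  - by rewrite lexx.
  - by rewrite subnn.
  by rewrite lerN2 (_ : N - k = (N - k.+1).+1)%N ?tm // subnSK.
have cE d (i : 'I_N) : 0 <= d -> cell d t' (rev_ord i) = cell d t i.
  move=> d0; rewrite /cell /t' /= subnSK // !leq_subr.
  by rewrite !clampN // !subKn ?(ltnW (ltn_ord i)) // opprK addrC.
apply: le_trans (upper_triangle c N a0 b0 tm').
rewrite (reindex_inj rev_ord_inj) /=; apply: ler_sum => i _.
rewrite (reindex_inj rev_ord_inj) /=; apply: ler_sum => j _.
rewrite -!(cE _ (rev_ord _)) // !rev_ordK.
rewrite le_eqVlt; apply/orP; left; apply/eqP; congr (_ * (nat_of_bool _)%:R).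
rewrite /t' !(ltnW (ltn_ord _)) -!subSn ?ltn_ord // !subSS.
by rewrite -opprD ltrNr.
Qed.

End Triangle.

(** * The area of a strip in a rectangle against Pollard's bound *)

Section Strip.
Variable R : realType.
Implicit Types (c : R) (t : nat -> R) (a b K : nat).

(* The truncation level t for which Pollard's theorem best bounds the sum of K
   values of rep A B when #|A| = a and #|B| = b; pollard_top is that bound. *)
Definition thresh a b K : nat := minn (minn a b) ((a + b - K)./2).

Definition pollard_top a b K : R :=
  a%:R * b%:R - (thresh a b K)%:R * (a%:R + b%:R - K%:R - (thresh a b K)%:R).

(** The rectangle [t i, t i.+1] x [t j, t j.+1] meets the strip |x + y| <= c. *)
Definition in_strip c t (i j : nat) : bool :=
  (t i + t j <= c) && (- c <= t i.+1 + t j.+1).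

Lemma sum_cell (a : R) t N : 0 <= a -> t 0%N <= - a -> a <= t N ->
  \sum_(i < N) cell a t i = 2 * a.
Proof.
move=> a0 h1 h2; rewrite /cell (telescope_nat (fun i => clamp a (t i))).
by rewrite clamp_big // clamp_small //; lra.
Qed.

(** With D = a + b - K, the half subtracted in e = (D - 1) / 2 pays for rounding D / 2 down: (D -
    1)^2 / 4 <= h (D - h) for h = D./2, in either parity. *)
Lemma thresh_bound a b K (e : R) : (a <= b)%N ->
  e = (a%:R + b%:R - K%:R - 1) / 2 ->
  pos e ^+ 2 - pos (e - a%:R) ^+ 2 <=
  (thresh a b K)%:R * (a%:R + b%:R - K%:R - (thresh a b K)%:R).
Proof.
move=> ab eE; rewrite /thresh (minn_idPl ab) !expr2.
have a0 : 0 <= a%:R :> R by [].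
have [abK|Kab] := leqP (a + b) K.
  have : (a%:R + b%:R <= K%:R :> R) by rewrite -natrD ler_nat.
  rewrite (eqP abK) minn0 mul0r => ?.
  by case: (posP e) => [[? ->]|[? ->]]; case: (posP (e - a%:R)) => [[? ->]|[? ->]];
    nra.
set D := (a + b - K)%N; have D0 : (0 < D)%N by rewrite subn_gt0.
have DE : a%:R + b%:R - K%:R = D%:R :> R by rewrite natrB ?natrD // ltnW.
have D1 : 1 <= D%:R :> R by rewrite (ler_nat _ 1).
have {}eE : e = (D%:R - 1) / 2 by rewrite eE DE.
rewrite DE; set h := D./2.
have Dh : D%:R = (odd D)%:R + 2 * h%:R :> R.
  by rewrite -{1}(odd_double_half D) natrD -muln2 natrM mulrC.
have oE : (odd D)%:R * (odd D)%:R = (odd D)%:R :> R.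
  by case: (odd D); rewrite ?mulr1 ?mulr0.
have h0 : 0 <= h%:R :> R by [].
have [ah|ha] := leqP a h.
  have ahR : a%:R <= h%:R :> R by rewrite ler_nat.
  move: oE Dh; set o : R := (odd D)%:R; rewrite eE => oE Dh.
  have o01 : 0 <= o <= 1 by rewrite /o; case: (odd D); rewrite /= ?lexx ?ler01.
  case: (posP ((D%:R - 1) / 2 : R)) => [[? ->]|[? ->]];
    case: (posP ((D%:R - 1) / 2 - a%:R : R)) => [[? ->]|[? ->]]; nra.
have haR : h%:R + 1 <= a%:R :> R by rewrite natr1 ler_nat.
have e0 : 0 <= e by rewrite eE; lra.
have o01 : 0 <= ((odd D)%:R : R) <= 1 by case: (odd D); rewrite /= ?lexx ?ler01.
have pe : pos e = (D%:R - 1) / 2 by rewrite /pos (max_idPr e0) eE.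
have pe' : 0 <= pos (e - a%:R) * pos (e - a%:R) by nra.
rewrite pe; apply: (@le_trans _ _ ((D%:R - 1) / 2 * ((D%:R - 1) / 2))); first by lra.
rewrite Dh; nra.
Qed.

(** The cells outside the strip lie in two opposite corners; the corner bounds are subtracted from
    the total area a b and compared by [thresh_bound]. *)
Lemma strip_sum_le a b K N t : (forall k, t k <= t k.+1) -> (a <= b)%N ->
  t 0%N <= - (b%:R / 2) -> b%:R / 2 <= t N ->
  pollard_top a b K <= \sum_(i < N) \sum_(j < N)
    cell (a%:R / 2) t i * cell (b%:R / 2) t j * (in_strip (K.+1%:R / 2) t i j)%:R.
Proof.
move=> tm ab t0 tN; set c := K.+1%:R / 2.
have a0 : 0 <= a%:R / 2 :> R by rewrite divr_ge0.
have b0 : 0 <= b%:R / 2 :> R by rewrite divr_ge0.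
have abR : a%:R <= b%:R :> R by rewrite ler_nat.
have U := upper_triangle c N a0 b0 tm; have L := lower_triangle c N a0 b0 tm.
have T : \sum_(i < N) \sum_(j < N) cell (a%:R / 2) t i * cell (b%:R / 2) t j
   = a%:R * b%:R.
  under eq_bigr do rewrite -mulr_sumr.
  by rewrite -mulr_suml !sum_cell //; lra.
have cE : a%:R / 2 + b%:R / 2 - c = (a%:R + b%:R - K%:R - 1) / 2.
  by rewrite /c -natr1; lra.
have B := thresh_bound ab cE.
rewrite (_ : a%:R / 2 + b%:R / 2 - c - a%:R = b%:R / 2 - c - a%:R / 2) in B; last by lra.
set S := leRHS; rewrite /pollard_top -T.
set Up := \sum_(i < N) _ in U; set Lo := \sum_(i < N) _ in L.
suff : \sum_(i < N) \sum_(j < N) cell (a%:R / 2) t i * cell (b%:R / 2) t j <=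
  S + (Up + Lo) by move: U L B; lra.
rewrite /S /Up /Lo -!big_split /=; apply: ler_sum => i _; rewrite -!big_split /=.
apply: ler_sum => j _; rewrite -!mulrDr -[leLHS]mulr1; apply: ler_wpM2l.
  by rewrite mulr_ge0 // cell_ge0.
rewrite /in_strip; case: (leP _ c) => _; case: (leP (- c)) => _ /=; lra.
Qed.

Lemma pollard_topC a b K : pollard_top a b K = pollard_top b a K.
Proof. by rewrite /pollard_top /thresh [minn a b]minnC [(a + b)%N]addnC; ring. Qed.

Lemma strip_sum a b K N t : (forall k, t k <= t k.+1) ->
  t 0%N <= - ((maxn a b)%:R / 2) -> (maxn a b)%:R / 2 <= t N ->
  pollard_top a b K <= \sum_(i < N) \sum_(j < N)
    cell (a%:R / 2) t i * cell (b%:R / 2) t j * (in_strip (K.+1%:R / 2) t i j)%:R.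
Proof.
move=> tm; have [/ltnW ab|ba] := ltnP a b; first by apply: strip_sum_le.
move=> t0 tN; rewrite pollard_topC; apply: le_trans (strip_sum_le K tm ba t0 tN) _.
rewrite exchange_big /= le_eqVlt; apply/orP; left; apply/eqP.
apply: eq_bigr => i _; apply: eq_bigr => j _; congr (_ * (nat_of_bool _)%:R).
  exact: mulrC.
by rewrite /in_strip addrC [t j.+1 + _]addrC.
Qed.

End Strip.

(** * Gaussian partition functions *)

Section Theta.
Variable R : realType.
Implicit Types (x beta : R) (n m : nat).

(** Gaussian partition function: the sum of exp (- beta i^2) over the integers i from -n to n. *)
Definition theta n beta : R :=
  1 + 2 * \sum_(i < n) expR (- (beta * i.+1%:R ^+ 2)).

Lemma theta_ge1 n beta : 1 <= theta n beta.
Proof.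
by rewrite lerDl mulr_ge0 // sumr_ge0 // => i _; apply: expR_ge0.
Qed.

Lemma theta_double n beta : 0 <= beta -> theta n beta <= theta (2 * n) (beta / 2).
Proof.
move=> b0; rewrite lerD2l ler_wpM2l //.
rewrite -!(big_mkord xpredT (fun i => expR (- (_ * i.+1%:R ^+ 2)))).
rewrite (big_cat_nat (n := n) (leq0n _) (leq_pmull _ _)) //=.
apply: ler_wpDr; first by rewrite sumr_ge0 // => i _; apply: expR_ge0.
apply: ler_sum => i _; rewrite ler_expR lerN2 ler_wpM2r ?sqr_ge0 //; lra.
Qed.

(* The half-integer points in Z(beta / 4) interlace the integer ones. *)
Lemma theta_quarter n : (0 < n)%N ->
  theta (4 * n) (n%:R^-1 / 4) <= 2 * theta n n%:R^-1 + 5.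
Proof.
move=> n0; pose g x : R := expR (- (n%:R^-1 * x ^+ 2)).
have nR : 0 < n%:R :> R by rewrite ltr0n.
have g_decr x y : 0 <= x -> x <= y -> g y <= g x.
  move=> x0 xy; rewrite ler_expR lerN2 ler_wpM2l ?invr_ge0 ?ler0n //.
  by rewrite ler_pXn2r // nnegrE // (le_trans x0).
have g_ge0 x : 0 <= g x by apply: expR_ge0.
pose T := \sum_(0 <= k < n) g k.+1%:R.
have thetaE : theta n n%:R^-1 = 1 + 2 * T by rewrite /theta /T big_mkord.
(* The odd numbers 2 k + 1 give the half-integers k + 1/2, the even numbers 2 k + 2 give k + 1. *)
have halves N : \sum_(i < 2 * N) expR (- (n%:R^-1 / 4 * i.+1%:R ^+ 2)) =
    \sum_(0 <= k < N) (g (k%:R + 2^-1) + g k.+1%:R).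
  rewrite big_mkord; elim: N => [|N IH]; first by rewrite !big_ord0.
  rewrite (_ : 2 * N.+1 = (2 * N).+2)%N; last by lia.
  rewrite !big_ord_recr /= IH -addrA; congr (_ + (expR _ + expR _)); congr (- _).
    by rewrite -[(2 * N).+1%:R]natr1 natrM; field; rewrite gt_eqF.
  rewrite -[(2 * N).+2%:R]natr1 -[(2 * N).+1%:R]natr1 -[N.+1%:R]natr1 natrM.
  by field; rewrite gt_eqF.
(* Each of the n extra terms is at most exp (- n), and n exp (- n) <= 1. *)
have tail : \sum_(0 <= k < 2 * n) g k.+1%:R <= T + 1.
  rewrite (big_cat_nat (n := n) (leq0n _) (leq_pmull _ _)) //= lerD2l.
  apply: (@le_trans _ _ (\sum_(n <= k < 2 * n) g n%:R)).
    by apply: ler_sum_nat => k /andP[nk _]; rewrite g_decr // ler_nat ltnW.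
  rewrite sumr_const_nat (_ : 2 * n - n = n)%N; last by lia.
  rewrite /g expr2 mulKf ?gt_eqF // expRN -[_ *+ n]mulr_natl.
  rewrite ler_pdivrMr ?expR_gt0 // mul1r.
  by apply: le_trans (expR_ge1Dx _); lra.
have head : \sum_(0 <= k < 2 * n) g (k%:R + 2^-1) <=
    1 + \sum_(0 <= k < 2 * n) g k.+1%:R.
  apply: (@le_trans _ _ (\sum_(0 <= k < 2 * n) g k%:R)).
    by apply: ler_sum_nat => k _; rewrite g_decr //; lra.
  apply: (@le_trans _ _ (\sum_(0 <= k < (2 * n).+1) g k%:R)).
    by rewrite big_nat_recr //= lerDl.
  rewrite big_nat_recl //= lerD2r /g expr0n mulr0 oppr0 expR0 //.
rewrite thetaE /theta (_ : 4 * n = 2 * (2 * n))%N; last by lia.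
by rewrite halves big_split /=; lra.
Qed.

(** For n = m^2 the first m terms of the sum are each at least exp (- 1). *)
Lemma theta_large B : exists2 n, (0 < n)%N & B <= theta n n%:R^-1 :> R.
Proof.
have e0 : 0 < expR (- 1) :> R by apply: expR_gt0.
pose m := (Num.bound `|B / (2 * expR (- 1))|).+1.
exists (m * m)%N; first by rewrite muln_gt0.
have mB : B <= 2 * (m%:R * expR (- 1)).
  have : B / (2 * expR (- 1)) <= m%:R.
    apply: le_trans (ler_norm _) _; apply: ltW.
    by apply: lt_le_trans (archi_boundP (normr_ge0 _)) _; rewrite ler_nat.
  by rewrite ler_pdivrMr ?mulr_gt0 // mulrCA.
apply: le_trans mB _; rewrite /theta; apply: ler_wpDl => //.
rewrite ler_pM2l //.
rewrite -(big_mkord xpredT (fun i => expR (- (_ * i.+1%:R ^+ 2)))).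
rewrite (big_cat_nat (n := m) (leq0n _) (leq_pmulr _ _)) //=.
apply: ler_wpDr; first by rewrite sumr_ge0 // => i _; apply: expR_ge0.
rewrite mulr_natl -[X in _ *+ X]subn0 -sumr_const_nat.
apply: ler_sum_nat => i /andP[_ im]; rewrite ler_expR lerN2.
rewrite ler_pdivrMl ?ltr0n ?muln_gt0 // mulr1 expr2 natrM.
by rewrite ler_pM // ler_nat.
Qed.

(* The ratios Z(beta / 2) / Z(beta) and Z(beta / 4) / Z(beta / 2) have product
   at most 2 + 5 / Z(beta), so one of them is essentially at most sqrt 2. *)
Lemma theta_ratio (eps B : R) : 0 < eps -> exists n (beta : R),
  [/\ 0 <= beta, B <= theta n beta &
      ln (theta (2 * n) (beta / 2)) <= ln (theta n beta) + ln 2 / 2 + eps].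
Proof.
move=> eps0.
(* The second bound gives 5 <= 4 eps Z0, so that 2 Z0 + 5 <= 2 Z0 (1 + 2 eps) <= 2 Z0 exp (2
   eps). *)
have [n n0 nB] := theta_large (Num.max B (5 / (4 * eps))).
have [nB1 nB2] : B <= theta n n%:R^-1 /\ 5 / (4 * eps) <= theta n n%:R^-1.
  by move: nB; rewrite ge_max => /andP[].
set Z0 := theta n _ in nB nB1 nB2; set b : R := n%:R^-1 in Z0 nB nB1 nB2.
have b0 : 0 <= b by rewrite invr_ge0.
have Z01 : 1 <= Z0 := theta_ge1 _ _.
have Z12 := theta_double n b0.
have [h|h] := leP (ln (theta (2 * n) (b / 2))) (ln Z0 + ln 2 / 2 + eps).
  by exists n, b.
exists (2 * n)%N, (b / 2); split; [by lra|by apply: le_trans Z12|].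
have Q := theta_quarter n0.
rewrite (_ : 2 * (2 * n) = 4 * n)%N; last by lia.
rewrite (_ : b / 2 / 2 = b / 4); last by lra.
have {}Q : ln (theta (4 * n) (b / 4)) <= ln (2 * Z0 + 5).
  by rewrite ler_ln // posrE; [apply: lt_le_trans (theta_ge1 _ _) | lra].
have E : ln (2 * Z0 + 5) <= ln 2 + ln Z0 + 2 * eps.
  rewrite -[2 * eps]expRK -!lnM ?posrE ?expR_gt0 ?mulr_gt0 //; [|lra..].
  rewrite ler_ln ?posrE; [|lra|by rewrite !mulr_gt0 ?expR_gt0 //; lra].
  apply: (@le_trans _ _ (2 * Z0 * (1 + 2 * eps))).
    by move: nB2; rewrite ler_pdivrMr; [lra|lra].
  by rewrite ler_wpM2l ?expR_ge1Dx //; lra.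
by lra.
Qed.

End Theta.

(** * The entropy power inequality on cells *)

Section Epi.
Variable R : realType.
Implicit Types (h : nat -> nat -> R) (t phi : nat -> R).

Lemma ln_le_subr1 (x : R) : 0 < x -> ln x <= x - 1.
Proof. by move=> x0; have := expR_ge1Dx (ln x); rewrite lnK ?posrE //; lra. Qed.

(** The pairs are grouped by i - j. On the right, j + d.+1 may reach N or more: the extra terms are
    nonnegative, and the full range of j lets each diagonal telescope in [epi_theta]. *)
Lemma below_diagonal_sum h N : (forall i j, 0 <= h i j) ->
  \sum_(i < N) \sum_(j < N) h i j * (j < i)%N%:R <=
  \sum_(d < N.-1) \sum_(j < N) h (j + d.+1)%N j.
Proof.
move=> h0; rewrite exchange_big /= [leRHS]exchange_big /=; apply: ler_sum => j _.
rewrite -(big_mkord xpredT (fun i => h i j * (j < i)%N%:R)).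
rewrite (big_cat_nat (n := j.+1)) //=.
rewrite [X in X + _]big_nat_cond [X in X + _]big1 ?add0r; last first.
  by move=> i /andP[/andP[_ ij] _]; rewrite ltnNge -ltnS ij mulr0.
rewrite -{1}[j.+1]add0n big_addn.
rewrite -(big_mkord xpredT (fun d => h (j + d.+1)%N j)).
rewrite [leRHS](big_cat_nat (n := (N - j.+1)%N)) //=; last first.
  by rewrite -subn1 leq_sub2l.
apply: ler_wpDr; first by rewrite sumr_ge0.
by apply: ler_sum => d _; rewrite addnS addnC -addnS ler_piMr //; case: (_ < _)%N.
Qed.

Lemma diagonal_sum h N : (forall i j, 0 <= h i j) ->
  \sum_(i < N) \sum_(j < N) h i j <= \sum_(j < N) h j j +
  \sum_(d < N.-1) (\sum_(j < N) h (j + d.+1)%N j + \sum_(j < N) h j (j + d.+1)%N).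
Proof.
move=> h0; rewrite big_split /=.
have L := below_diagonal_sum N h0.
have U := @below_diagonal_sum (fun i j => h j i) N (fun i j => h0 j i).
rewrite [X in X <= _]exchange_big /= in U.
have D : \sum_(i < N) \sum_(j < N) h i j * (i == j)%:R = \sum_(j < N) h j j.
  apply: eq_bigr => i _; rewrite (bigD1 i) //= eqxx mulr1 big1 ?addr0 // => j ji.
  by rewrite eq_sym (negPf ji) mulr0.
rewrite -D; apply: le_trans (lerD (lexx _) (lerD L U)).
rewrite -!big_split /=; apply: ler_sum => i _; rewrite -!big_split /=.
apply: ler_sum => j _; rewrite -!mulrDr -[leLHS]mulr1 ler_wpM2l // -!natrD ler1n.
by rewrite -val_eqE /=; case: (ltngtP i j).
Qed.

Lemma sum_pair_weight N phi (x : nat -> R) : \sum_(i < N) phi i = 1 ->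
  \sum_(i < N) \sum_(j < N) phi i * phi j * (x i + x j) =
  2 * \sum_(i < N) phi i * x i.
Proof.
move=> p1; pose S := \sum_(j < N) phi j * x j.
have E i : \sum_(j < N) phi i * phi j * (x i + x j) = phi i * x i + phi i * S.
  transitivity (\sum_(j < N) (phi i * x i * phi j + phi i * (phi j * x j))).
    by apply: eq_bigr => j _; ring.
  by rewrite big_split /= -!mulr_sumr p1 mulr1.
under eq_bigr do rewrite E.
by rewrite big_split /= -mulr_suml p1 mul1r -/S; ring.
Qed.

(** Pointwise, l i + l j >= 2 sqrt (l i l j) deals with the lengths, and ln x <= x - 1 at x = q g /
    (phi i phi j V) deals with q. Averaged against phi i phi j, the latter costs nothing because q g
    has total mass at most V. *)
Lemma epi_general N phi (l : nat -> R) (g q : nat -> nat -> R) V :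
  (forall i, (i < N)%N -> 0 < phi i) -> (forall i, (i < N)%N -> 0 < l i) ->
  (forall i j, (i < N)%N -> (j < N)%N -> 0 < g i j) ->
  (forall i j, (i < N)%N -> (j < N)%N -> 0 < q i j) ->
  0 < V -> \sum_(i < N) phi i = 1 ->
  \sum_(i < N) \sum_(j < N) q i j * g i j <= V ->
  \sum_(i < N) \sum_(j < N) phi i * phi j * ln (q i j / (l i + l j)) <=
  ln V + \sum_(i < N) phi i * ln (phi i / l i) - ln 2 + \sum_(i < N) phi i * ln (phi i)
  - \sum_(i < N) \sum_(j < N) phi i * phi j * ln (g i j).
Proof.
move=> phi0 l0 g0 q0 V0 p1 qgV.
have p2 : \sum_(i < N) \sum_(j < N) phi i * phi j = 1.
  by under eq_bigr do rewrite -mulr_sumr p1 mulr1.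
pose x i : R := ln (phi i) - ln (l i) / 2.
have xE : 2 * \sum_(i < N) phi i * x i =
    \sum_(i < N) phi i * ln (phi i / l i) + \sum_(i < N) phi i * ln (phi i).
  rewrite mulr_sumr -big_split /=; apply: eq_bigr => i _.
  by rewrite ln_div ?posrE ?phi0 ?l0 // /x; lra.
rewrite -sum_pair_weight // in xE.
suff : \sum_(i < N) \sum_(j < N) phi i * phi j * ln (q i j / (l i + l j)) <=
    \sum_(i < N) \sum_(j < N) (q i j * g i j / V + phi i * phi j * (ln V - ln 2 - 1)
      + phi i * phi j * (x i + x j) - phi i * phi j * ln (g i j)).
  have cst c : \sum_(i < N) \sum_(j < N) phi i * phi j * c = c.
    by under eq_bigr do rewrite -mulr_suml; rewrite -mulr_suml p2 mul1r.
  under [X in _ <= X -> _]eq_bigr do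
    rewrite !big_split /= -mulr_suml.
  rewrite !big_split /= -mulr_suml cst xE.
  under [X in _ <= _ + X -> _]eq_bigr do rewrite sumrN.
  rewrite sumrN => /le_trans; apply.
  have : (\sum_(i < N) \sum_(j < N) q i j * g i j) / V <= 1.
    by rewrite ler_pdivrMr // mul1r.
  by lra.
apply: ler_sum => i _; apply: ler_sum => j _.
have pi := phi0 i (ltn_ord i); have pj := phi0 j (ltn_ord j).
have li := l0 i (ltn_ord i); have lj := l0 j (ltn_ord j).
have gij := g0 i j (ltn_ord i) (ltn_ord j).
have qij := q0 i j (ltn_ord i) (ltn_ord j).
have amgm : ln 2 + (ln (l i) + ln (l j)) / 2 <= ln (l i + l j).
  have h : ln (4 * (l i * l j)) <= ln ((l i + l j) * (l i + l j)).
    rewrite ler_ln ?posrE ?mulr_gt0 ?addr_gt0 //.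
    by have := sqr_ge0 (l i - l j); rewrite expr2; lra.
  have l4 : ln 4 = 2 * ln 2 :> R.
    by rewrite (_ : 4 = 2 * 2) ?lnM ?posrE //; lra.
  move: h; rewrite !lnM ?posrE ?mulr_gt0 ?addr_gt0 // l4; lra.
have gibbs := @ln_le_subr1 (q i j * g i j / (phi i * phi j * V)).
have {}gibbs := gibbs (divr_gt0 (mulr_gt0 qij gij) (mulr_gt0 (mulr_gt0 pi pj) V0)).
rewrite !ln_div ?lnM ?posrE ?mulr_gt0 ?addr_gt0 // in gibbs *.
have pp : 0 < phi i * phi j by rewrite mulr_gt0.
have -> : q i j * g i j / V =
    phi i * phi j * (q i j * g i j / (phi i * phi j * V)).
  by field; rewrite !gt_eqF.
rewrite -!mulrDr -mulrBr ler_pM2l //; rewrite /x; lra.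
Qed.

End Epi.

(** * Discrete Gaussian weights *)

Section EpiTheta.
Variable R : realType.
Implicit Types (beta : R) (n : nat).

(** Discrete Gaussian on 0, ..., 2 n, centred at n so that the indices are naturals. *)
Definition gauss n beta (i : nat) : R :=
  expR (- (beta * (i%:R - n%:R) ^+ 2)) / theta n beta.

Lemma theta_gt0 n beta : 0 < theta n beta.
Proof. exact: lt_le_trans (theta_ge1 _ _). Qed.

Lemma gauss_gt0 n beta i : 0 < gauss n beta i.
Proof. by rewrite divr_gt0 ?expR_gt0 ?theta_gt0. Qed.

Lemma gauss_le n beta i : 0 <= beta -> gauss n beta i <= (theta n beta)^-1.
Proof.
move=> b0; rewrite ler_pdivrMr ?theta_gt0 // mulVf ?gt_eqF ?theta_gt0 //.
by rewrite expR_le1 oppr_le0 mulr_ge0 // sqr_ge0.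
Qed.

Lemma sum_gauss n beta : \sum_(i < (2 * n).+1) gauss n beta i = 1.
Proof.
rewrite -mulr_suml.
suff -> : \sum_(i < (2 * n).+1) expR (- (beta * (i%:R - n%:R) ^+ 2)) = theta n beta.
  by rewrite divff // gt_eqF // theta_gt0.
rewrite -(big_mkord xpredT (fun i => expR (- (beta * (i%:R - n%:R) ^+ 2)))).
rewrite (big_cat_nat (n := n)) //=; last by lia.
rewrite [X in _ + X]big_ltn; last by lia.
rewrite subrr expr0n mulr0 oppr0 expR0 /theta addrCA; congr (_ + _).
rewrite mulr_natl mulr2n; congr (_ + _).
  rewrite big_mkord (reindex_inj rev_ord_inj) /=; apply: eq_bigr => i _.
  by congr (expR _); rewrite natrB //; ring.
rewrite -{1}[n.+1]add0n big_addn big_mkord (_ : (2 * n).+1 - n.+1 = n)%N; last by lia.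
by apply: eq_bigr => i _; congr (expR _); rewrite addnC natrD; ring.
Qed.

(** Discrete Gaussian weight of i - j at beta / 2; differences range over |i - j| <= 2 n, whence the
    size of the partition function. *)
Definition gauss_diff n beta (i j : nat) : R :=
  expR (- (beta / 2 * (i%:R - j%:R) ^+ 2)) / theta (2 * n) (beta / 2).

(* The second moments cancel since E (i - j)^2 <= 2 E i^2 for the centred i. *)
Lemma gauss_cross_entropy n beta (N := (2 * n).+1) : 0 <= beta ->
  \sum_(i < N) gauss n beta i * ln (gauss n beta i) -
  \sum_(i < N) \sum_(j < N) gauss n beta i * gauss n beta j * ln (gauss_diff n beta i j) <=
  ln (theta (2 * n) (beta / 2)) - ln (theta n beta).
Proof.
move=> b0; set g := gauss_diff n beta; set phi := gauss n beta.
set Z0 := theta n beta; set Z1 := theta _ (beta / 2).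
have Z00 : 0 < Z0 := theta_gt0 _ _.
have Z10 : 0 < Z1 := theta_gt0 _ _.
pose a (i : nat) : R := i%:R - n%:R.
have p1 : \sum_(i < N) phi i = 1 := sum_gauss n beta.
pose A := \sum_(i < N) phi i * a i; pose Q := \sum_(i < N) phi i * (a i ^+ 2).
have -> : \sum_(i < N) phi i * ln (phi i) = - (beta * Q) - ln Z0.
  transitivity (\sum_(i < N) (- beta * (phi i * a i ^+ 2) - phi i * ln Z0)).
    apply: eq_bigr => i _; rewrite {2}/phi /gauss ln_div ?posrE ?expR_gt0 // expRK.
    by rewrite -/Z0 -/(a i); ring.
  by rewrite sumrB -mulr_sumr -mulr_suml p1 -/Q; ring.
have -> : \sum_(i < N) \sum_(j < N) phi i * phi j * ln (g i j) =
    - (beta * Q) + beta * A ^+ 2 - ln Z1.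
  have E (i : nat) : \sum_(j < N) phi i * phi j * ln (g i j) =
     - (beta / 2) * (phi i * a i ^+ 2) + beta * A * (phi i * a i)
     - (beta / 2 * Q + ln Z1) * phi i.
    transitivity (\sum_(j < N) (- (beta / 2) * (phi i * a i ^+ 2) * phi j +
      beta * (phi i * a i) * (phi j * a j) - (beta / 2 * phi i) * (phi j * a j ^+ 2) -
      ln Z1 * phi i * phi j)).
      apply: eq_bigr => j _; rewrite /g /gauss_diff ln_div ?posrE ?expR_gt0 // expRK /a -/Z1.
      by field.
    by rewrite !sumrB big_split /= -!mulr_sumr p1 -/A -/Q; ring.
  under eq_bigr do rewrite E.
  by rewrite sumrB big_split /= -!mulr_sumr p1 -/A -/Q; lra.
have : 0 <= beta * A ^+ 2 by rewrite mulr_ge0 ?sqr_ge0.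
lra.
Qed.

(** For fixed i - j the increments of [Th] telescope over j to at most V, and the weights
    [gauss_diff] depend on i - j only, with sum 1 over -2 n, ..., 2 n. So [epi_general] applies with
    total mass V, and [gauss_cross_entropy] bounds the Gaussian terms. *)
Lemma epi_theta n beta t (Th : R -> R) (V : R) (N := (2 * n).+1) (phi := gauss n beta) :
  0 <= beta -> 0 < V -> (forall k, t k <= t k.+1) -> (forall i, (i < N)%N -> t i < t i.+1) ->
  (forall x y, x <= y -> Th x <= Th y) -> (forall x y, Th y - Th x <= V) ->
  (forall i j, (i < N)%N -> (j < N)%N -> Th (t i + t j) < Th (t i.+1 + t j.+1)) ->
  \sum_(i < N) \sum_(j < N) phi i * phi j *
     ln ((Th (t i.+1 + t j.+1) - Th (t i + t j)) / (t i.+1 - t i + (t j.+1 - t j))) <=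
  ln V + \sum_(i < N) phi i * ln (phi i / (t i.+1 - t i)) - ln 2
  + ln (theta (2 * n) (beta / 2)) - ln (theta n beta).
Proof.
move=> b0 V0 tm tlt Thm ThV Thlt.
pose g := gauss_diff n beta.
pose q i j := Th (t i.+1 + t j.+1) - Th (t i + t j).
have Z0 : 0 < theta (2 * n) (beta / 2) := theta_gt0 _ _.
have q0 i j : 0 <= q i j by rewrite subr_ge0 Thm // lerD.
have g0 i j : 0 < g i j by rewrite divr_gt0 // expR_gt0.
have qgV : \sum_(i < N) \sum_(j < N) q i j * g i j <= V.
  have qC i j : q i j * g i j = q j i * g j i.
    by rewrite /q /g /gauss_diff [t i.+1 + _]addrC [t i + _]addrC -[(i%:R - j%:R) ^+ 2]sqrrN opprB.
  apply: le_trans (@diagonal_sum _ (fun i j => q i j * g i j) N _) _.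
    by move=> i j; rewrite mulr_ge0 // ltW.
  have diag d : \sum_(j < N) q (j + d)%N j * g (j + d)%N j <=
      V * (expR (- (beta / 2 * d%:R ^+ 2)) / theta (2 * n) (beta / 2)).
    have gE (j : nat) : g (j + d)%N j =
        expR (- (beta / 2 * d%:R ^+ 2)) / theta (2 * n) (beta / 2).
      by rewrite /g /gauss_diff natrD addrAC subrr add0r.
    under eq_bigr do rewrite gE.
    rewrite -mulr_suml ler_wpM2r ?divr_ge0 ?expR_ge0 ?(ltW Z0) //.
    by rewrite /q (telescope_nat (fun j => Th (t (j + d)%N + t j))) ThV.
  have D0 : \sum_(j < N) q j j * g j j <= V / theta (2 * n) (beta / 2).
    have := diag 0%N; under eq_bigr do rewrite addn0.
    by rewrite expr0n mulr0 oppr0 expR0 div1r.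
  have diag' d : \sum_(j < N) q j (j + d)%N * g j (j + d)%N <=
      V * (expR (- (beta / 2 * d%:R ^+ 2)) / theta (2 * n) (beta / 2)).
    by under eq_bigr do rewrite qC; apply: diag.
  pose e d := V * (expR (- (beta / 2 * d%:R ^+ 2)) / theta (2 * n) (beta / 2)).
  apply: (@le_trans _ _ (V / theta (2 * n) (beta / 2) + \sum_(d < 2 * n) (e d.+1 + e d.+1))).
    by apply: lerD D0 _; apply: ler_sum => d _; apply: lerD (diag _) (diag' _).
  have eE d : e d + e d = V / theta (2 * n) (beta / 2) *
      (2 * expR (- (beta / 2 * d%:R ^+ 2))) by rewrite /e; ring.
  under eq_bigr do rewrite eE.
  rewrite -!mulr_sumr -[X in X + _]mulr1 -mulrDr -/(theta (2 * n) (beta / 2)).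
  by rewrite divfK // gt_eqF.
have := @epi_general R N phi (fun i => t i.+1 - t i) g q V.
move=> /(_ (fun i _ => gauss_gt0 n beta i)) h.
have {}h := h (fun i iN => ltac:(by rewrite subr_gt0 tlt)) (fun i j _ _ => g0 i j).
have {}h := h (fun i j iN jN => ltac:(by rewrite subr_gt0 Thlt)) V0 (sum_gauss n beta) qgV.
apply: le_trans h _; have := gauss_cross_entropy n b0; rewrite -/N -/phi -/g; lra.
Qed.

End EpiTheta.

(** * Symmetric rearrangement on the line *)

Lemma abel_sum (R : comPzRingType) (f C : nat -> R) m :
  \sum_(a < m) f a * (C a.+1 - C a) =
  \sum_(a < m) (f a - f a.+1) * C a.+1 + f m * C m - f 0%N * C 0%N.
Proof.
elim: m => [|m IH]; first by rewrite !big_ord0; ring.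
by rewrite !big_ord_recr /= IH; ring.
Qed.

Lemma noninc_leq (R : numDomainType) (f : nat -> R) i j :
  (forall a, f a.+1 <= f a) -> (i <= j)%N -> f j <= f i.
Proof.
move=> fn; elim: j => [|j IH]; first by rewrite leqn0 => /eqP ->.
rewrite leq_eqVlt => /orP[/eqP <-|/IH] //; exact: le_trans.
Qed.

Section Rearrangement.
Variables (R : realType) (m : nat) (f : nat -> R).
Hypotheses (f_noninc : forall a, f a.+1 <= f a) (f_last : 0 < f m) (f_end : f m.+1 = 0)
  (f_sum : \sum_(a < m.+1) f a = 1).

Let half (a : nat) : R := a%:R / 2.
Let v a := f a - f a.+1.

Let v_ge0 a : 0 <= v a. Proof. by rewrite subr_ge0. Qed.
Let half_ge0 a : 0 <= half a. Proof. by rewrite divr_ge0. Qed.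

(* The symmetric decreasing rearrangement of f has density f a at distance
   between a / 2 and (a + 1) / 2 from the origin; it is a mixture of uniform
   laws on the intervals [- half a.+1, half a.+1]. *)
Definition rearr_cdf (z : R) : R := \sum_(a < m.+1) v a * (clamp (half a.+1) z + half a.+1).

(** As f m.+1 = 0, the widest layer has density f m, and it covers the whole interval. *)
Lemma rearr_cdf_slope x y : - half m.+1 <= x -> x <= y -> y <= half m.+1 ->
  f m * (y - x) <= rearr_cdf y - rearr_cdf x.
Proof.
move=> x0 xy y0; rewrite /rearr_cdf -sumrB big_ord_recr /=.
apply: ler_wpDl.
  apply: sumr_ge0 => a _; rewrite -mulrBr mulr_ge0 ?v_ge0 //.
  by rewrite opprD addrACA subrr addr0 subr_ge0 clamp_mono.
have yid : clamp (half m.+1) y = y by rewrite clamp_id //; lra.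
have xid : clamp (half m.+1) x = x by rewrite clamp_id //; lra.
by rewrite yid xid /v f_end; lra.
Qed.

Lemma rearr_cdf_lo : rearr_cdf (- half m.+1) = 0.
Proof.
rewrite /rearr_cdf big1 // => a _; rewrite clamp_small ?half_ge0 //.
  by rewrite addNr mulr0.
by rewrite lerN2 /half ler_wpM2r // ler_nat.
Qed.

Lemma rearr_cdf_hi : rearr_cdf (half m.+1) = 1.
Proof.
have <- : \sum_(a < m.+1) f a * (a.+1%:R - a%:R) = 1.
  by rewrite -[RHS]f_sum; apply: eq_bigr => a _; rewrite -natr1; ring.
rewrite (abel_sum f (fun a => a%:R)) f_end mul0r mulr0 subr0 addr0.
apply: eq_bigr => a _; congr (_ * _); rewrite clamp_big ?half_ge0 //.
  by rewrite /half; lra.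
by rewrite /half ler_wpM2r // ler_nat.
Qed.

Lemma rearr_cdf_continuous : continuous rearr_cdf.
Proof.
move=> x; rewrite /rearr_cdf.
apply: cvg_big => [|a _]; first exact: add_continuous.
apply: cvgM; first exact: cvg_cst.
by apply: cvgD; [exact: clamp_continuous | exact: cvg_cst].
Qed.

Variables (N : nat) (phi : nat -> R).
Hypotheses (phi_gt0 : forall i, 0 < phi i) (phi_sum : \sum_(i < N) phi i = 1).

(** The intermediate value theorem yields cut points of the rearranged law at the partial sums of
    phi; the positive slope f m fixes the end points, orders the cuts and bounds the cell
    lengths. *)
Lemma quantiles : exists t : nat -> R,
  [/\ t 0%N = - half m.+1, t N = half m.+1, forall k, t k <= t k.+1,
     forall k, - half m.+1 <= t k <= half m.+1 &
     forall i, (i < N)%N -> [/\ t i < t i.+1, (t i.+1 - t i) * f m <= phi i &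
        phi i = rearr_cdf (t i.+1) - rearr_cdf (t i)]].
Proof.
(* The indicator keeps Phi constant beyond N, so that t is monotone on all of [nat]. *)
pose Phi k := \sum_(i < N) phi i * (i < k)%N%:R.
have Phi_mono k : Phi k <= Phi k.+1.
  apply: ler_sum => i _; apply: ler_wpM2l; first exact: ltW.
  by rewrite ler_nat ltnS; case: (ltnP i k) => // /ltnW ->.
have PhiS k : (k < N)%N -> Phi k.+1 - Phi k = phi k.
  move=> kN; rewrite /Phi -sumrB (bigD1 (Ordinal kN)) //= ltnn ltnSn mulr1 mulr0 subr0.
  rewrite big1 ?addr0 // => i ik; rewrite -mulrBr ltnS.
  have -> : (i <= k)%N = (i < k)%N by rewrite leq_eqVlt -[_ == _]/(i == Ordinal kN) (negPf ik).
  by rewrite subrr mulr0.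
have Phi0 : Phi 0%N = 0 by rewrite /Phi big1 // => i _; rewrite mulr0.
have PhiN : Phi N = 1 by rewrite -[RHS]phi_sum; apply: eq_bigr => i _; rewrite ltn_ord mulr1.
have Phi_ge0 k : 0 <= Phi k by apply: sumr_ge0 => i _; rewrite mulr_ge0 // ltW.
have Phi_le1 k : Phi k <= 1.
  by rewrite -[leRHS]phi_sum; apply: ler_sum => i _; apply: ler_piMr; [exact: ltW|rewrite lern1; case: (_ < _)%N].
have hm : - half m.+1 <= half m.+1 by have := half_ge0 m.+1; lra.
have /choice[t tP] : forall k, exists z, - half m.+1 <= z <= half m.+1 /\ rearr_cdf z = Phi k.
  move=> k; have [||z] := @IVT R rearr_cdf (- half m.+1) (half m.+1) (Phi k) hm.
  - by apply: continuous_subspaceT; exact: rearr_cdf_continuous.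
  - by rewrite rearr_cdf_lo rearr_cdf_hi (min_idPl _) ?(max_idPr _) // Phi_ge0 Phi_le1.
  by rewrite in_itv /= => zI zE; exists z.
have tI k : - half m.+1 <= t k <= half m.+1 by case: (tP k).
have tE k : rearr_cdf (t k) = Phi k by case: (tP k).
have slope x y : - half m.+1 <= x <= half m.+1 -> - half m.+1 <= y <= half m.+1 ->
    x <= y -> f m * (y - x) <= rearr_cdf y - rearr_cdf x.
  by move=> /andP[x0 _] /andP[_ y0] xy; apply: rearr_cdf_slope.
have mono k : t k <= t k.+1.
  rewrite leNgt; apply/negP => lt; have := slope _ _ (tI k.+1) (tI k) (ltW lt).
  rewrite !tE; have := Phi_mono k.
  have : 0 < f m * (t k - t k.+1) by rewrite mulr_gt0 ?subr_gt0.
  by lra.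
exists t; split=> //.
- have := slope _ _ (_ : - half m.+1 <= - half m.+1 <= half m.+1) (tI 0%N).
  rewrite lexx hm => /(_ isT); have /andP[t0 _] := tI 0%N.
  move=> /(_ t0); rewrite tE rearr_cdf_lo Phi0 subrr pmulr_rle0 //; lra.
- have := slope _ _ (tI N) (_ : - half m.+1 <= half m.+1 <= half m.+1).
  rewrite lexx hm => /(_ isT); have /andP[_ tN] := tI N.
  move=> /(_ tN); rewrite tE rearr_cdf_hi PhiN subrr pmulr_rle0 //; lra.
move=> i iN; have E : phi i = rearr_cdf (t i.+1) - rearr_cdf (t i) by rewrite !tE PhiS.
split=> //.
  rewrite lt_neqAle mono andbT; apply/eqP => e; have := phi_gt0 i.
  by rewrite E e subrr ltxx.
by rewrite mulrC E; apply: slope.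
Qed.

Variables (t : nat -> R).
Hypotheses (t_start : t 0%N = - half m.+1) (t_end : t N = half m.+1)
  (t_mono : forall k, t k <= t k.+1) (t_range : forall k, - half m.+1 <= t k <= half m.+1)
  (phiE : forall i, (i < N)%N -> phi i = rearr_cdf (t i.+1) - rearr_cdf (t i))
  (t_lt : forall i, (i < N)%N -> t i < t i.+1).

Lemma phi_cells i : (i < N)%N -> phi i = \sum_(a < m.+1) v a * cell (half a.+1) t i.
Proof.
move=> iN; rewrite phiE // /rearr_cdf -sumrB; apply: eq_bigr => a _.
by rewrite -mulrBr opprD addrACA subrr addr0.
Qed.

(** Jensen's inequality for x ln x on each cell, where phi i / (t i.+1 - t i) is the mean
    density. *)
Lemma quantile_entropy :
  \sum_(i < N) phi i * ln (phi i / (t i.+1 - t i)) <= \sum_(a < m.+1) f a * ln (f a).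
Proof.
have f_gt0 (a : 'I_m.+1) : 0 < f a.
  by apply: lt_le_trans f_last (noninc_leq f_noninc _); rewrite -ltnS.
(* Length of the part of cell i at distance between a / 2 and (a + 1) / 2 from the origin; each such
   ring has total length 1. *)
pose lam i a := cell (half a.+1) t i - cell (half a) t i.
have lam_ge0 i a : 0 <= lam i a.
  by rewrite subr_ge0 clamp_diff ?half_ge0 // /half ler_wpM2r // ler_nat.
have lam_row i : \sum_(a < m.+1) lam i a = t i.+1 - t i.
  rewrite /lam (telescope_nat (fun a => cell (half a) t i)) /cell.
  have cid k : clamp (half m.+1) (t k) = t k.
    by have /andP[? ?] := t_range k; rewrite clamp_id.
  by rewrite [half 0]mul0r !clamp0 !cid; lra.
have lam_col (a : 'I_m.+1) : \sum_(i < N) lam i a = 1.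
  have sc (b : nat) : (b <= m.+1)%N -> \sum_(i < N) cell (half b) t i = b%:R.
    move=> bm; have hb : half b <= half m.+1 by rewrite ler_wpM2r // ler_nat.
    by rewrite sum_cell ?t_start ?t_end ?lerN2 // /half; lra.
  by rewrite sumrB !sc // ?(ltnW (ltn_ord a)) // -natr1; lra.
have lam_phi i : (i < N)%N -> phi i = \sum_(a < m.+1) f a * lam i a.
  move=> iN; rewrite phi_cells // (abel_sum f (fun a => cell (half a) t i)) f_end mul0r addr0.
  suff -> : cell (half 0) t i = 0 by rewrite mulr0 subr0.
  by rewrite /cell /half mul0r !clamp0 subrr.
have -> : \sum_(a < m.+1) f a * ln (f a) =
    \sum_(i < N) \sum_(a < m.+1) lam i a * (f a * ln (f a)).
  rewrite exchange_big /=; apply: eq_bigr => a _.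
  by rewrite -mulr_suml lam_col mul1r.
apply: ler_sum => i _; have tl := t_lt (ltn_ord i).
set mu := phi i / _; have mu0 : 0 < mu by rewrite divr_gt0 // subr_gt0.
apply: (@le_trans _ _ (\sum_(a < m.+1) (f a * lam i a * (ln mu + 1) - lam i a * mu))).
  have muE : (t i.+1 - t i) * mu = phi i.
    by rewrite /mu mulrC divfK // subr_eq0 gt_eqF.
  by rewrite sumrB -!mulr_suml -lam_phi // lam_row muE; lra.
apply: ler_sum => a _; rewrite -[f a * _]mulrC -mulrA -mulrBr; apply: ler_wpM2l => //.
have := @ln_le_subr1 R (mu / f a) (divr_gt0 mu0 (f_gt0 a)).
have e : f a * (mu / f a - 1) = mu - f a by field; rewrite gt_eqF.
by move=> /(ler_wpM2l (ltW (f_gt0 a))); rewrite e ln_div ?posrE //; lra.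
Qed.

End Rearrangement.

Lemma in_strip_mono (R : realType) (c c' : R) t i j :
  c <= c' -> in_strip c t i j -> in_strip c' t i j.
Proof.
by move=> cc /andP[h1 h2]; apply/andP; split; lra.
Qed.

(** * A layered antiderivative for the law of the sum *)

Section Layer.
Variables (R : realType) (P : nat) (rho : nat -> R).
Hypotheses (rho_noninc : forall k, rho k.+1 <= rho k) (rho_end : rho P.+1 = 0).

(* An antiderivative of the even function equal to rho k at distance between
   k / 2 + 1 and (k + 3) / 2: each ring is pushed outwards to absorb the width
   of the cells, at the cost of 2 * rho 0 in the total mass. *)
Definition layer_cdf (z : R) : R :=
  \sum_(k < P.+1) (rho k - rho k.+1) * clamp (k.+3%:R / 2) z.

Lemma layer_cdf_mono x y : x <= y -> layer_cdf x <= layer_cdf y.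
Proof.
move=> xy; apply: ler_sum => k _; rewrite ler_wpM2l ?subr_ge0 //.
exact: clamp_mono.
Qed.

Lemma layer_cdf_osc x y :
  layer_cdf y - layer_cdf x <= \sum_(k < P.+1) rho k + 2 * rho 0%N.
Proof.
have -> : \sum_(k < P.+1) rho k + 2 * rho 0%N =
    \sum_(k < P.+1) (rho k - rho k.+1) * k.+3%:R.
  have := abel_sum rho (fun a => a.+2%:R) P.+1.
  rewrite rho_end mul0r addr0 => e.
  rewrite (_ : \sum_(k < P.+1) rho k = \sum_(a < P.+1) rho a * (a.+3%:R - a.+2%:R)).
    by rewrite e; ring.
  by apply: eq_bigr => a _; rewrite -[a.+3%:R]natr1; ring.
rewrite /layer_cdf -sumrB; apply: ler_sum => k _.
rewrite -mulrBr ler_wpM2l ?subr_ge0 //.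
have c0 : 0 <= k.+3%:R / 2 :> R by rewrite divr_ge0.
by have := clamp_le y c0; have := clamp_ge (k.+3%:R / 2) x; lra.
Qed.

Lemma layer_cdf_slope k x y : (k <= P)%N -> - (k.+3%:R / 2) <= x -> x <= y ->
  y <= k.+3%:R / 2 -> rho k * (y - x) <= layer_cdf y - layer_cdf x.
Proof.
move=> kP x0 xy y0; rewrite /layer_cdf -sumrB.
rewrite -(big_mkord xpredT (fun k => (rho k - rho k.+1) * clamp (k.+3%:R / 2) y -
   (rho k - rho k.+1) * clamp (k.+3%:R / 2) x)).
rewrite (big_cat_nat (n := k)) //=; last exact: leqW.
apply: ler_wpDl.
  by apply: sumr_ge0 => a _; rewrite -mulrBr mulr_ge0 ?subr_ge0 // clamp_mono.
have -> : rho k = \sum_(k <= a < P.+1) (rho a - rho a.+1).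
  have := telescope_sumr (fun a => - rho a) (leqW kP).
  rewrite rho_end oppr0 sub0r opprK => <-.
  by apply: eq_bigr => a _; rewrite opprK addrC.
rewrite mulr_suml; apply: ler_sum_nat => a /andP[ka _].
have kaR : k.+3%:R <= a.+3%:R :> R by rewrite ler_nat.
by rewrite -mulrBr !clamp_id //; lra.
Qed.

End Layer.

(** * The entropy comparison on the line *)

Section Line.
Variables (R : realType) (m P : nat) (f rho r : nat -> R).
Hypotheses (f_noninc : forall a, f a.+1 <= f a) (f_last : 0 < f m) (f_end : f m.+1 = 0)
  (f_sum : \sum_(a < m.+1) f a = 1) (mP : (m.+1 + m.+1 <= P.+1)%N)
  (rho_noninc : forall k, rho k.+1 <= rho k) (rho_end : rho P.+1 = 0)
  (rho_gt0 : forall k, (k <= P)%N -> 0 < rho k)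
  (r_sum : \sum_(k < P.+1) r k = 1)
  (r_major : forall k, (k <= P)%N -> \sum_(j < k.+1) r j <=
     \sum_(a < m.+1) \sum_(b < m.+1) (f a - f a.+1) * (f b - f b.+1) *
       pollard_top R a.+1 b.+1 k.+1).

(** The half-width is that of [strip_sum] for sums of k.+1 values. *)
Let good (t : nat -> R) k i j := in_strip (k.+2%:R / 2) t i j.
Let L k := ln (rho k).

(** Summation by parts gives the partial sums of r the weights L k - L k.+1, nonnegative as rho
    decreases, so bounds on partial sums pass to the average of the logarithm. *)
Lemma major_abel (w : nat -> nat -> R) N t :
  (forall k, (k <= P)%N -> \sum_(j < k.+1) r j <=
     \sum_(i < N) \sum_(j < N) w i j * (good t k i j)%:R) ->
  \sum_(i < N) \sum_(j < N) w i j = 1 ->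
  \sum_(k < P.+1) r k * L k <= \sum_(i < N) \sum_(j < N) w i j *
    (L P + \sum_(k < P) (L k - L k.+1) * (good t k i j)%:R).
Proof.
move=> wr w1; pose G k := \sum_(j < k) r j.
have -> : \sum_(k < P.+1) r k * L k = L P + \sum_(k < P) (L k - L k.+1) * G k.+1.
  rewrite big_ord_recr /= addrC.
  have -> : \sum_(k < P) r k * L k = \sum_(k < P) L k * (G k.+1 - G k).
    by apply: eq_bigr => k _; rewrite /G big_ord_recr /= [_ + r k]addrC addrK mulrC.
  rewrite abel_sum /G big_ord0 mulr0 subr0.
  have : \sum_(k < P) r k + r P = 1 by rewrite -[RHS]r_sum big_ord_recr.
  move=> e; rewrite (_ : r P = 1 - \sum_(k < P) r k); last by lra.
  ring.
apply: (@le_trans _ _ (L P + \sum_(k < P) (L k - L k.+1) *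
    \sum_(i < N) \sum_(j < N) w i j * (good t k i j)%:R)).
  rewrite lerD2l; apply: ler_sum => k _; rewrite ler_wpM2l //.
    rewrite subr_ge0 ler_ln ?posrE ?rho_gt0 // ltnW //.
  exact: wr (ltnW (ltn_ord k)).
rewrite le_eqVlt; apply/orP; left; apply/eqP.
under [RHS]eq_bigr do under eq_bigr do rewrite mulrDr mulr_sumr.
under [RHS]eq_bigr do rewrite big_split /= -mulr_suml exchange_big /=.
rewrite big_split /= -mulr_suml w1 mul1r exchange_big /=; congr (_ + _).
apply: eq_bigr => k _; rewrite mulr_sumr; apply: eq_bigr => i _.
by rewrite mulr_sumr; apply: eq_bigr => j _; ring.
Qed.

(** The strips are nested, so the increments of L telescope from the first strip that the pair
    meets. *)
Lemma good_level t i j : good t P i j -> exists2 k, (k <= P)%N & 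
  good t k i j /\ L P + \sum_(a < P) (L a - L a.+1) * (good t a i j)%:R = L k.
Proof.
move=> gP; have ex : exists k, good t k i j by exists P.
case: (ex_minnP ex) => k gk kmin.
have kP : (k <= P)%N by apply: kmin.
exists k => //; split => //.
have gE a : good t a i j = (k <= a)%N.
  apply/idP/idP => [/kmin //|ka]; apply: in_strip_mono gk.
  by rewrite ler_wpM2r // ler_nat.
rewrite -(big_mkord xpredT (fun a => (L a - L a.+1) * (good t a i j)%:R)).
rewrite (big_cat_nat (n := k)) //= [X in _ + (X + _)]big_nat_cond big1 ?add0r.
  rewrite (@telescope_sumr_eq _ k P (fun a => - L a)) // => [|a /andP[ka _]].
    by rewrite opprK addNKr.
  by rewrite gE ka mulr1 opprK addrC.
by move=> a /andP[/andP[_ ak] _]; rewrite gE leqNgt ak mulr0.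
Qed.

(** Cut the rearranged density into cells of Gaussian mass and score a pair of cells by ln (rho k)
    for the first strip it meets. By [major_abel] the mean score is an upper bound for the left
    side; each score is at most the logarithm of the mean slope of [layer_cdf] across the pair, to
    which [epi_theta] applies. *)
Lemma line_entropy (eps : R) : 0 < eps ->
  \sum_(k < P.+1) r k * L k <= \sum_(a < m.+1) f a * ln (f a) - ln 2 / 2 + eps +
    ln (\sum_(k < P.+1) rho k + 2 * rho 0%N).
Proof.
move=> eps0.
(* A partition function of at least 4 / f m makes each Gaussian mass at most f m / 4, hence each
   cell of length at most 1 / 4. *)
have [n [beta [b0 thB thr]]] := theta_ratio (4 / f m) eps0.
pose N := (2 * n).+1; pose phi := gauss n beta.
have phi0 i : 0 < phi i := gauss_gt0 n beta i.
have phi1 : \sum_(i < N) phi i = 1 := sum_gauss n beta.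
have [t [t0 tN tm tI tP]] := quantiles f_noninc f_last f_end f_sum phi0 phi1.
have tlt i : (i < N)%N -> t i < t i.+1 by move=> /tP[].
have phiE i : (i < N)%N -> phi i = rearr_cdf m f (t i.+1) - rearr_cdf m f (t i).
  by move=> /tP[].
have tshort i : (i < N)%N -> t i.+1 - t i <= 1 / 4.
  move=> /tP[_ h _]; have := gauss_le n i b0; rewrite -/phi => h'.
  have h4 : (theta n beta)^-1 <= f m / 4.
    rewrite -[leRHS]invrK lef_pV2 ?posrE ?theta_gt0 ?invr_gt0 ?divr_gt0 //.
    by rewrite invf_div.
  rewrite -(ler_pM2r f_last); lra.
pose w i j := phi i * phi j.
have w1 : \sum_(i < N) \sum_(j < N) w i j = 1.
  by under eq_bigr do rewrite -mulr_sumr phi1 mulr1.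
have wr k : (k <= P)%N -> \sum_(j < k.+1) r j <=
     \sum_(i < N) \sum_(j < N) w i j * (good t k i j)%:R.
  move=> kP; apply: le_trans (r_major kP) _.
  pose v a := f a - f a.+1; pose c (a i : nat) := cell (a.+1%:R / 2) t i.
  have -> : \sum_(i < N) \sum_(j < N) w i j * (good t k i j)%:R =
     \sum_(a < m.+1) \sum_(b < m.+1) v a * v b *
       \sum_(i < N) \sum_(j < N) c a i * c b j * (good t k i j)%:R.
    transitivity (\sum_(i < N) \sum_(j < N) \sum_(a < m.+1) \sum_(b < m.+1)
       v a * v b * (c a i * c b j * (good t k i j)%:R)).
      apply: eq_bigr => i _; apply: eq_bigr => j _.
      rewrite /w (phi_cells phiE (ltn_ord i)) (phi_cells phiE (ltn_ord j)).
      rewrite -mulrA mulr_suml; apply: eq_bigr => a _.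
      by rewrite mulr_suml mulr_sumr; apply: eq_bigr => b _; rewrite /v /c; ring.
    transitivity (\sum_(a < m.+1) \sum_(b < m.+1) \sum_(i < N) \sum_(j < N) 
       v a * v b * (c a i * c b j * (good t k i j)%:R)).
      under eq_bigr do rewrite exchange_big /=.
      rewrite exchange_big /=; apply: eq_bigr => a _.
      under eq_bigr do rewrite exchange_big /=.
      by rewrite exchange_big.
    apply: eq_bigr => a _; apply: eq_bigr => b _; rewrite mulr_sumr.
    by apply: eq_bigr => i _; rewrite mulr_sumr.
  apply: ler_sum => a _; apply: ler_sum => b _.
  apply: ler_wpM2l; first by rewrite mulr_ge0 // subr_ge0.
  have ab : (maxn a.+1 b.+1)%:R / 2 <= m.+1%:R / 2 :> R.
    by rewrite ler_wpM2r // ler_nat geq_max !ltn_ord.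
  by apply: strip_sum => //; rewrite ?t0 ?tN ?lerN2.
have K := major_abel wr w1; apply: le_trans K _.
set V := \sum_(k < _) rho k + _.
have rho_ge0 k : (k <= P)%N -> 0 <= rho k by move=> /rho_gt0/ltW.
have V0 : 0 < V.
  rewrite /V ltr_wpDl // ?mulr_gt0 ?rho_gt0 // sumr_ge0 // => k _.
  by rewrite rho_ge0 // -ltnS.
pose Th := layer_cdf P rho.
(* Two cells have total length at most 1 / 2, so a pair meeting the strip of half-width (k + 2) / 2
   stays within (k + 3) / 2, where [layer_cdf] has slope at least rho k. *)
have key (i j : nat) : (i < N)%N -> (j < N)%N -> exists2 k, (k <= P)%N &
    L P + \sum_(a < P) (L a - L a.+1) * (good t a i j)%:R = L k /\
    rho k * (t i.+1 - t i + (t j.+1 - t j)) <= Th (t i.+1 + t j.+1) - Th (t i + t j).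
  move=> iN jN.
  have gP : good t P i j.
    have /andP[i1 i2] := tI i; have /andP[j1 j2] := tI j.
    have /andP[i3 i4] := tI i.+1; have /andP[j3 j4] := tI j.+1.
    have mPR : m.+1%:R + m.+1%:R <= P.+2%:R :> R.
      by rewrite -natrD ler_nat leqW.
    by rewrite /good /in_strip; apply/andP; split; lra.
  have [k kP [gk e]] := good_level gP; exists k => //; split => //.
  have := tshort i iN; have := tshort j jN; have := tlt i iN; have := tlt j jN.
  move=> hi hj si sj; move: gk => /andP[g1 g2].
  have kE : k.+3%:R = k.+2%:R + 1 :> R by rewrite natr1.
  rewrite (_ : t i.+1 - t i + (t j.+1 - t j) = t i.+1 + t j.+1 - (t i + t j)); last by lra.
  by apply: layer_cdf_slope => //; rewrite ?kE; lra.
have E := @epi_theta R n beta t Th V b0 V0 tm tlt.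
have {}E := E (fun x y => @layer_cdf_mono R P rho rho_noninc x y).
have {}E := E (@layer_cdf_osc R P rho rho_noninc rho_end).
have q0 i j : (i < N)%N -> (j < N)%N -> Th (t i + t j) < Th (t i.+1 + t j.+1).
  move=> iN jN; have [k kP [_ h]] := key i j iN jN.
  rewrite -subr_gt0; apply: lt_le_trans h; rewrite mulr_gt0 ?rho_gt0 //.
  by rewrite addr_gt0 // subr_gt0 tlt.
have {}E := E q0.
have Q := quantile_entropy f_noninc f_last f_end phi0 t0 tN tm tI phiE tlt.
apply: (@le_trans _ _ (\sum_(i < N) \sum_(j < N) phi i * phi j *
   ln ((Th (t i.+1 + t j.+1) - Th (t i + t j)) / (t i.+1 - t i + (t j.+1 - t j))))); last first.
  apply: le_trans E _; rewrite -/N -/phi.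
  by move: Q thr; lra.
apply: ler_sum => i _; apply: ler_sum => j _; apply: ler_wpM2l.
  by rewrite mulr_ge0 // ltW.
have [k kP [-> h]] := key i j (ltn_ord i) (ltn_ord j).
have l0 : 0 < t i.+1 - t i + (t j.+1 - t j) by rewrite addr_gt0 // subr_gt0 tlt.
rewrite ler_ln ?posrE ?rho_gt0 ?divr_gt0 // ?subr_gt0 ?q0 //.
by rewrite ler_pdivlMr.
Qed.

End Line.

(** * Rearranging laws on 'F_p *)

Section Decreasing.
Variables (R : realType) (T : finType) (u : T -> R).
Hypothesis u_ge0 : forall x, 0 <= u x.

Definition ranking : seq T := sort (fun x y => u y <= u x) (enum T).
Definition dec (k : nat) : R := nth 0 (map u ranking) k.
Definition top (k : nat) : {set T} := [set x | x \in take k ranking]%SET.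

Lemma size_ranking : size ranking = #|T|.
Proof. by rewrite size_sort cardE. Qed.

Lemma uniq_ranking : uniq ranking.
Proof. by rewrite sort_uniq enum_uniq. Qed.

Lemma mem_ranking x : x \in ranking.
Proof. by rewrite mem_sort mem_enum. Qed.

Lemma dec_end k : (#|T| <= k)%N -> dec k = 0.
Proof. by move=> h; rewrite /dec nth_default // size_map size_ranking. Qed.

Lemma dec_ge0 k : 0 <= dec k.
Proof.
have [h|h] := ltnP k #|T|; last by rewrite dec_end.
have : dec k \in map u ranking by rewrite mem_nth // size_map size_ranking.
by move=> /mapP[x _ ->].
Qed.

Lemma dec_noninc k : dec k.+1 <= dec k.
Proof.
have [h|h] := ltnP k.+1 #|T|; last by rewrite dec_end // dec_ge0.
have /(sortedP 0) : sorted (fun x y : R => y <= x) (map u ranking).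
  by rewrite sorted_map; apply: sort_sorted => x y; apply: le_total.
by apply; rewrite size_map size_ranking.
Qed.

Lemma sum_dec (phi : R -> R) : \sum_(k < #|T|) phi (dec k) = \sum_x phi (u x).
Proof.
transitivity (\sum_(x <- ranking) phi (u x)); last first.
  by rewrite -big_enum; apply: perm_big; rewrite perm_sort.
rewrite -(big_map u xpredT phi) (big_nth 0) size_map size_ranking big_mkord.
by [].
Qed.

Lemma sum_dec_eq (phi : R -> R) n : #|T| = n ->
  \sum_(k < n) phi (dec k) = \sum_x phi (u x).
Proof. by move=> <-; apply: sum_dec. Qed.

Lemma dec_index x : dec (index x ranking) = u x.
Proof.
rewrite /dec (nth_map x) ?nth_index ?mem_ranking //.
by rewrite index_mem mem_ranking.
Qed.

Lemma mem_top k x : (x \in top k) = (index x ranking < k)%N.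
Proof. by rewrite inE in_take // mem_ranking. Qed.

Lemma card_top k : (k <= #|T|)%N -> #|top k| = k.
Proof.
move=> kT; rewrite cardsE; have /card_uniqP -> := take_uniq k uniq_ranking.
by rewrite size_takel // size_ranking.
Qed.

Lemma sum_top k : (k <= #|T|)%N -> \sum_(j < k) dec j = \sum_(x in top k) u x.
Proof.
move=> kT; transitivity (\sum_(x <- take k ranking) u x).
  rewrite -(big_map u xpredT id) (big_nth 0) size_map size_takel ?size_ranking //.
  rewrite big_mkord; apply: eq_bigr => j _.
  by rewrite map_take nth_take.
rewrite big_uniq ?take_uniq ?uniq_ranking //=; apply: eq_bigl => x.
by rewrite inE.
Qed.

(** Layer-cake formula: x lies in [top a.+1] exactly when a is at least its rank, and the
    differences telescope from there. *)
Lemma level_sum x n : (#|T| <= n)%N \/ dec n = 0 ->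
  u x = \sum_(a < n) (dec a - dec a.+1) * (x \in top a.+1)%:R.
Proof.
move=> hn; have {hn} dn : dec n = 0 by case: hn => // /dec_end.
set i := index x ranking.
have -> : \sum_(a < n) (dec a - dec a.+1) * (x \in top a.+1)%:R =
    \sum_(0 <= a < n) (dec a - dec a.+1) * (i <= a)%N%:R.
  by rewrite big_mkord; apply: eq_bigr => a _; rewrite mem_top ltnS.
have [ni|ni] := leqP n i.
  rewrite big_nat big1; last first.
    by move=> a /= an; rewrite leqNgt (leq_trans an ni) mulr0.
  rewrite -dec_index -/i; apply/eqP; rewrite eq_le dec_ge0 andbT -dn.
  exact: noninc_leq dec_noninc ni.
rewrite (big_cat_nat (n := i)) //=; last exact: ltnW.
rewrite [X in X + _]big_nat big1 ?add0r; last first.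
  by move=> a /= ai; rewrite leqNgt ai mulr0.
rewrite (@telescope_sumr_eq _ i n (fun a => - dec a)) ?(ltnW ni) //.
  by rewrite dn oppr0 sub0r opprK /i dec_index.
by move=> a /andP[ia _]; rewrite ia mulr1 opprK addrC.
Qed.

Lemma dec_support h : (#|[set x | u x != 0%R]%SET| <= h)%N -> dec h = 0.
Proof.
move=> sh; apply/eqP; apply: contraTT isT => dh.
have [hT|hT] := ltnP h #|T|; last by rewrite dec_end ?eqxx in dh.
suff : (h.+1 <= #|[set x | u x != 0%R]%SET|)%N by rewrite ltnNge sh.
rewrite -{1}(card_top hT); apply: subset_leq_card; apply/fintype.subsetP => x.
rewrite mem_top inE ltnS => ih; rewrite -dec_index.
have h0 : 0 < dec h by rewrite lt_neqAle eq_sym dh dec_ge0.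
by rewrite gt_eqF // (lt_le_trans h0) // (noninc_leq dec_noninc).
Qed.

End Decreasing.

(** * Convolution on 'F_p and the case of small support *)

Section Convolution.
Variables (R : realType) (p : nat).
Hypothesis p_pr : prime p.
Implicit Types f g : 'F_p -> R.

Definition conv f g (x : 'F_p) : R := \sum_y f y * g (x - y).

Definition ent f : R := - \sum_x f x * ln (f x).

Lemma conv_ge0 f g x : (forall x, 0 <= f x) -> (forall x, 0 <= g x) -> 0 <= conv f g x.
Proof. by move=> f0 g0; apply: sumr_ge0 => y _; rewrite mulr_ge0. Qed.

Lemma sum_conv f g : \sum_x conv f g x = (\sum_x f x) * (\sum_x g x).
Proof.
rewrite exchange_big mulr_suml /=; apply: eq_bigr => y _.
rewrite -mulr_sumr; congr (_ * _).
by rewrite (reindex_inj (addIr y)) /=; apply: eq_bigr => x _; rewrite addrK.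
Qed.

Lemma conv_le f g d x : (forall x, 0 <= f x) -> (forall x, g x <= d) ->
  \sum_x f x = 1 -> conv f g x <= d.
Proof.
move=> f0 gd f1; rewrite -[d]mul1r -f1 mulr_suml; apply: ler_sum => y _.
exact: ler_wpM2l.
Qed.

(** On S, rep + min (t, rep) <= t + rep; off S, min (t, rep) <= rep. Sum over x and insert Pollard's
    lower bound for the truncated sum. *)
Lemma rep_sum_le (A B S : {set 'F_p}) : (#|A| + #|B| <= p)%N ->
  (\sum_(x in S) rep A B x)%:R <= pollard_top R #|A| #|B| #|S|.
Proof.
move=> ABp; set t := thresh #|A| #|B| #|S|.
have tA : (t <= #|A|)%N by rewrite /t /thresh !geq_min leqnn.
have tB : (t <= #|B|)%N by rewrite /t /thresh !geq_min leqnn orbT.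
have P := pollard p_pr ABp tA tB.
have H : (\sum_(x in S) rep A B x + \sum_x minn t (rep A B x) <= #|S| * t + #|A| * #|B|)%N.
  rewrite -sum_rep -sum_nat_const [X in (X + _ <= _)%N]big_mkcond.
  rewrite [X in (_ <= X + _)%N]big_mkcond -!big_split /=; apply: leq_sum => x _.
  by case: (x \in S); rewrite ?add0n ?geq_minr // addnC leq_add2r geq_minl.
have tAB : (t <= #|A| + #|B|)%N by rewrite (leq_trans tA) ?leq_addr.
have {}H := leq_trans (leq_add (leqnn _) P) H.
move: H; rewrite -(ler_nat R) !natrD !natrM natrB // natrD /pollard_top -/t; lra.
Qed.

(** Both factors are expanded over their top sets, which turns the k largest values of the
    convolution into sums of [rep]. The conditions on m keep the sizes of two top sets at most p in
    total, as Pollard's theorem requires. *)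
Lemma conv_majorized f m k : (forall x, 0 <= f x) -> (m + m <= p)%N -> dec f m = 0 ->
  (k <= p)%N ->
  \sum_(j < k) dec (conv f f) j <= \sum_(a < m) \sum_(b < m)
    (dec f a - dec f a.+1) * (dec f b - dec f b.+1) * pollard_top R a.+1 b.+1 k.
Proof.
move=> f0 mp fm kp; have cT : #|'F_p| = p := card_Fp p_pr.
have c0 x : 0 <= conv f f x by apply: conv_ge0.
rewrite sum_top ?cT // /conv; set S := top _ k.
have cS : #|S| = k by rewrite card_top ?cT.
pose v a := dec f a - dec f a.+1; pose A a := top f a.+1.
have cA (a : 'I_m) : #|A a| = a.+1.
  by rewrite card_top // cT (leq_trans (ltn_ord a)) // (leq_trans (leq_addr m m)).
have fE x : f x = \sum_(a < m) v a * (x \in A a)%:R by apply: level_sum; [|right].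
have -> : \sum_(x in S) \sum_y f y * f (x - y) =
   \sum_(a < m) \sum_(b < m) v a * v b * (\sum_(x in S) rep (A a) (A b) x)%:R.
  transitivity (\sum_(x in S) \sum_y \sum_(a < m) \sum_(b < m)
     v a * v b * ((y \in A a)%:R * (x - y \in A b)%:R)).
    apply: eq_bigr => x _; apply: eq_bigr => y _; rewrite {1}fE {1}fE.
    rewrite mulr_suml; apply: eq_bigr => a _; rewrite mulr_sumr.
    by apply: eq_bigr => b _; ring.
  under eq_bigr do rewrite exchange_big /=.
  rewrite exchange_big /=; apply: eq_bigr => a _.
  under eq_bigr do rewrite exchange_big /=.
  rewrite exchange_big /=; apply: eq_bigr => b _.
  under eq_bigr do rewrite -mulr_sumr.
  rewrite -mulr_sumr natr_sum; congr (_ * _); apply: eq_bigr => x _.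
  rewrite /rep natr_sum [RHS]big_mkcond /=; apply: eq_bigr => y _.
  by case: (y \in A a); rewrite ?mul1r ?mul0r.
apply: ler_sum => a _; apply: ler_sum => b _; apply: ler_wpM2l.
  by rewrite mulr_ge0 // subr_ge0 dec_noninc.
rewrite -cS -(cA a) -(cA b); apply: rep_sum_le; rewrite !cA.
by apply: leq_trans mp; rewrite leq_add.
Qed.

(** [line_entropy] for the sorted values of f and of its convolution. One d is the loss allowed in
    the Gaussian ratio; the other five come from the total mass, at most 1 + 5 d. *)
Lemma ent_conv_small_support f d : (forall x, 0 <= f x) -> \sum_x f x = 1 ->
  (forall x, f x <= d) -> (2 * #|[set x | f x != 0%R]%SET| <= p)%N ->
  ent f + ln 2 / 2 - 6 * d <= ent (conv f f).
Proof.
move=> f0 f1 fd supp; have cT : #|'F_p| = p := card_Fp p_pr.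
set r := conv f f.
have r0 x : 0 <= r x by apply: conv_ge0.
have r1 : \sum_x r x = 1 by rewrite sum_conv f1 mulr1.
have rd x : r x <= d by apply: conv_le.
have p0 : (0 < p)%N := prime_gt0 p_pr.
have d0 : 0 < d.
  rewrite ltNge; apply/negP => dn; have : \sum_x f x <= 0.
    by apply: sumr_le0 => x _; apply: le_trans dn.
  by rewrite f1 ler10.
have f1' : \sum_(k < p) dec f k = 1 by rewrite (sum_dec_eq f id cT).
have fS := dec_support f0 (leqnn #|[set x | f x != 0%R]%SET|).
have ex : exists M, dec f M == 0 by exists #|[set x | f x != 0%R]%SET|; rewrite fS.
case: (ex_minnP ex) => -[|m] /eqP fM Mmin.
  move: f1'; rewrite big1 => [/eqP|k _]; first by rewrite eq_sym oner_eq0.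
  by apply/eqP; rewrite eq_le dec_ge0 // andbT -fM (noninc_leq (dec_noninc f0)).
have mp : (m.+1 + m.+1 <= p)%N.
  by apply: leq_trans supp; rewrite mul2n -addnn leq_add ?Mmin ?fS.
have fm : 0 < dec f m.
  rewrite lt_neqAle dec_ge0 // andbT eq_sym; apply/negP => /Mmin.
  by rewrite ltnn.
have fge k : (m < k)%N -> dec f k = 0.
  by move=> mk; apply/eqP; rewrite eq_le dec_ge0 // andbT -fM (noninc_leq (dec_noninc f0)).
have trunc (phi : R -> R) : phi 0 = 0 -> \sum_(k < m.+1) phi (dec f k) = \sum_x phi (f x).
  move=> phi0; rewrite -(sum_dec_eq _ _ cT) -!(big_mkord xpredT (fun k => phi (dec f k))).
  rewrite [RHS](big_cat_nat (n := m.+1)) //=; last first.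
    by apply: leq_trans mp; apply: leq_addr.
  rewrite [X in _ + X](_ : _ = 0) ?addr0 // big_nat big1 // => k /andP[mk _].
  by rewrite fge.
pose P := p.-1; have PE : P.+1 = p := prednK p0.
(* Adding d / p keeps the logarithms finite where r vanishes. *)
pose rho k := if (k <= P)%N then dec r k + d / p%:R else 0.
have dp : 0 < d / p%:R by rewrite divr_gt0 // ltr0n.
have rho_gt0 k : (k <= P)%N -> 0 < rho k.
  by move=> kP; rewrite /rho kP ltr_wpDl ?dec_ge0.
have rho_noninc k : rho k.+1 <= rho k.
  rewrite /rho; case: (ltnP k P) => kP.
    by rewrite (ltnW kP) lerD2r dec_noninc.
  by case: ifP => // _; rewrite addr_ge0 ?dec_ge0 // ltW.
have rho_end : rho P.+1 = 0 by rewrite /rho ltnn.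
have r1' : \sum_(k < P.+1) dec r k = 1 by rewrite PE (sum_dec_eq r id cT).
have major k : (k <= P)%N -> \sum_(j < k.+1) dec r j <=
     \sum_(a < m.+1) \sum_(b < m.+1) (dec f a - dec f a.+1) * (dec f b - dec f b.+1) *
       pollard_top R a.+1 b.+1 k.+1.
  by move=> kP; apply: conv_majorized; rewrite // -PE ltnS.
have mP : (m.+1 + m.+1 <= P.+1)%N by rewrite PE.
have f1m : \sum_(a < m.+1) dec f a = 1 by rewrite (trunc id).
have := line_entropy (dec_noninc f0) fm fM f1m mP rho_noninc rho_end rho_gt0 r1' major d0.
rewrite (trunc (fun x => x * ln x)) ?mul0r // => E.
have rE : - ent r <= \sum_(k < P.+1) dec r k * ln (rho k).
  rewrite /ent opprK -(sum_dec_eq r (fun x => x * ln x) cT) PE; apply: ler_sum => k _.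
  have kP : (k <= P)%N by rewrite -ltnS PE.
  have : 0 <= dec r k := dec_ge0 r0 k.
  rewrite le_eqVlt => /orP[/eqP <-|k0]; first by rewrite !mul0r.
  rewrite ler_pM2l // ler_ln ?posrE ?rho_gt0 // /rho kP; lra.
have VE : \sum_(k < P.+1) rho k + 2 * rho 0%N <= 1 + 5 * d.
  have -> : \sum_(k < P.+1) rho k = 1 + d.
    transitivity (\sum_(k < P.+1) (dec r k + d / p%:R)).
      by apply: eq_bigr => k _; rewrite /rho -ltnS ltn_ord.
    rewrite big_split /= r1' sumr_const card_ord PE -[(d / _) *+ _]mulr_natr divfK //.
    by rewrite pnatr_eq0 -lt0n.
  have r0d : dec r 0%N <= d.
    have := mem_nth 0 (_ : 0 < size (map r (ranking r)))%N.
    by rewrite size_map size_ranking cT => /(_ p0)/mapP[x _]; rewrite -/(dec r 0%N) => ->.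
  have dpd : d / p%:R <= d.
    rewrite ler_pdivrMr ?ltr0n //; apply: ler_peMr; first exact: ltW.
    by rewrite ler1n.
  rewrite /rho /=; lra.
have V0 : 0 < \sum_(k < P.+1) rho k + 2 * rho 0%N.
  rewrite ltr_wpDl // ?mulr_gt0 ?rho_gt0 // sumr_ge0 // => k _.
  by rewrite ltW // rho_gt0 // -ltnS.
have := ln_le_subr1 V0; rewrite /ent in rE *; lra.
Qed.

End Convolution.

(** * Mixtures *)

Section Mixture.
Variables (R : realType) (p : nat).
Implicit Types f g mu nu : 'F_p -> R.

Definition prob f := (forall x, 0 <= f x) /\ \sum_x f x = 1.

Lemma gibbs_term (a b : R) : 0 <= a -> 0 <= b -> (b = 0 -> a = 0) ->
  a * ln b + a - b <= a * ln a.
Proof.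
rewrite le_eqVlt => /orP[/eqP <- b0 _|a0]; first by rewrite !mul0r; lra.
rewrite le_eqVlt => /orP[/eqP <- /(_ erefl) ae|b0 _]; first by rewrite ae ltxx in a0.
have := ln_le_subr1 (divr_gt0 b0 a0).
rewrite ln_div ?posrE // => /(ler_wpM2l (ltW a0)).
rewrite [leRHS]mulrBr mulrCA divff ?gt_eqF // !mulr1; lra.
Qed.

Lemma xlnx_ge (a : R) : 0 <= a -> a - 1 <= a * ln a.
Proof.
move=> a0; have := @gibbs_term a 1 a0 ler01; rewrite ln1 mulr0 add0r; apply.
by move=> /eqP; rewrite oner_eq0.
Qed.

(** Gibbs' inequality compares each nu i with the mixture; where the mixture vanishes, so does every
    component of positive weight. *)
Lemma ent_concave (I : finType) (lam : I -> R) (nu : I -> 'F_p -> R) :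
  (forall i, 0 <= lam i) -> \sum_i lam i = 1 -> (forall i, prob (nu i)) ->
  \sum_i lam i * ent (nu i) <= ent (fun x => \sum_i lam i * nu i x).
Proof.
move=> l0 l1 nuP; pose mu x := \sum_i lam i * nu i x; rewrite -/mu.
have mu0 x : 0 <= mu x.
  by apply: sumr_ge0 => i _; rewrite mulr_ge0 //; case: (nuP i).
have mu1 : \sum_x mu x = 1.
  rewrite exchange_big /= -[RHS]l1; apply: eq_bigr => i _.
  by rewrite -mulr_sumr; case: (nuP i) => _ ->; rewrite mulr1.
have muE : \sum_x mu x * ln (mu x) = \sum_i \sum_x lam i * (nu i x * ln (mu x)).
  rewrite exchange_big /=; apply: eq_bigr => x _; rewrite {1}/mu mulr_suml.
  by apply: eq_bigr => i _; rewrite mulrA.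
have : \sum_x mu x * ln (mu x) <=
    \sum_i \sum_x (lam i * (nu i x * ln (nu i x)) - lam i * nu i x + lam i * mu x).
  rewrite muE; apply: ler_sum => i _; apply: ler_sum => x _.
  have [nu0 _] := nuP i.
  have := l0 i; rewrite le_eqVlt => /orP[/eqP <-|li]; first by rewrite !mul0r subrr addr0.
  rewrite -mulrBr -mulrDr ler_pM2l //.
  have := @gibbs_term (nu i x) (mu x) (nu0 x) (mu0 x) => H.
  suff : mu x = 0 -> nu i x = 0 by move=> /H; lra.
  move=> m0; apply/eqP; rewrite eq_le nu0 andbT -(pmulr_rle0 _ li) -m0 /mu.
  rewrite (bigD1 i) //= lerDl; apply: sumr_ge0 => j _.
  by rewrite mulr_ge0 //; case: (nuP j).
have -> : \sum_i \sum_x (lam i * (nu i x * ln (nu i x)) - lam i * nu i x + lam i * mu x)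
   = - \sum_i lam i * ent (nu i).
  rewrite -sumrN; apply: eq_bigr => i _; rewrite big_split /= sumrB -!mulr_sumr mu1.
  by case: (nuP i) => _ ->; rewrite /ent; ring.
by rewrite /ent; lra.
Qed.

Definition mix (a : R) f g x := a * f x + (1 - a) * g x.

Lemma mix_prob a f g : 0 <= a <= 1 -> prob f -> prob g -> prob (mix a f g).
Proof.
move=> /andP[a0 a1] [f0 f1] [g0 g1]; split.
  by move=> x; rewrite addr_ge0 // mulr_ge0 ?subr_ge0.
by rewrite big_split /= -!mulr_sumr f1 g1; ring.
Qed.

Lemma ent_mix_ge a f g : 0 <= a <= 1 -> prob f -> prob g ->
  a * ent f + (1 - a) * ent g <= ent (mix a f g).
Proof.
move=> /andP[a0 a1] fP gP.
pose lam (b : bool) := if b then a else 1 - a; pose nu (b : bool) := if b then f else g.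
have l0 b : 0 <= lam b by case: b; rewrite /lam ?subr_ge0.
have l1 : \sum_b lam b = 1 by rewrite big_bool /lam /=; ring.
have nuP b : prob (nu b) by case: b.
have := ent_concave l0 l1 nuP; rewrite big_bool /=.
congr (_ <= ent _); apply/funext => x; exact: big_bool.
Qed.

(** The mixture dominates both a f and (1 - a) g, and ln is increasing; the excess is the entropy of
    the mixing bit. *)
Lemma ent_mix_le a f g : 0 < a < 1 -> prob f -> prob g ->
  ent (mix a f g) <= a * ent f + (1 - a) * ent g - a * ln a - (1 - a) * ln (1 - a).
Proof.
move=> /andP[a0 a1] [f0 f1] [g0 g1]; have b0 : 0 < 1 - a by rewrite subr_gt0.
have term (c : R) u v : 0 < c -> 0 <= u -> c * u <= v ->
    c * (u * ln u) + c * ln c * u <= c * u * ln v.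
  move=> c0; rewrite le_eqVlt => /orP[/eqP <-|u0] cuv; first by rewrite !(mul0r, mulr0) addr0.
  have cu : 0 < c * u by rewrite mulr_gt0.
  have : ln (c * u) <= ln v by rewrite ler_ln ?posrE // (lt_le_trans cu).
  rewrite lnM ?posrE // => /(ler_wpM2l (ltW cu)); lra.
have : \sum_x (a * (f x * ln (f x)) + a * ln a * f x +
      ((1 - a) * (g x * ln (g x)) + (1 - a) * ln (1 - a) * g x))
    <= \sum_x mix a f g x * ln (mix a f g x).
  apply: ler_sum => x _; rewrite {1}/mix [leRHS]mulrDl; apply: lerD; apply: term => //; rewrite /mix.
    by rewrite lerDl mulr_ge0 // ltW.
  by rewrite lerDr mulr_ge0 // ltW.
by rewrite !big_split /= -!mulr_sumr f1 g1 /ent; lra.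
Qed.

Lemma conv_prob f g : prob f -> prob g -> prob (conv f g).
Proof.
move=> [f0 f1] [g0 g1]; split; first by move=> x; apply: conv_ge0.
by rewrite sum_conv f1 g1 mulr1.
Qed.

Lemma ent_shift f y : ent (fun x => f (x - y)) = ent f.
Proof.
rewrite /ent (reindex_inj (addIr y)) /=; congr (- _); apply: eq_bigr => x _.
by rewrite addrK.
Qed.

(** The convolution is a mixture of translates of g with weights f. *)
Lemma ent_conv_ge_r f g : prob f -> prob g -> ent g <= ent (conv f g).
Proof.
move=> [f0 f1] [g0 g1].
have := @ent_concave _ f (fun y x => g (x - y)) f0 f1.
under eq_bigr do rewrite ent_shift.
rewrite -mulr_suml f1 mul1r; apply=> y; split => //.
by rewrite (reindex_inj (addIr y)) /= -[RHS]g1; apply: eq_bigr => x _; rewrite addrK.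
Qed.

Lemma convC f g : conv f g = conv g f.
Proof.
apply/funext => x; rewrite /conv (reindex_inj (subrI x)) /=; apply: eq_bigr => y _.
by rewrite subKr mulrC.
Qed.

Lemma ent_conv_ge_l f g : prob f -> prob g -> ent f <= ent (conv f g).
Proof. by move=> fP gP; rewrite convC; apply: ent_conv_ge_r. Qed.

Lemma conv_mixl a f g h : conv (mix a f g) h = mix a (conv f h) (conv g h).
Proof.
apply/funext => x; rewrite /mix /conv !mulr_sumr -big_split /=.
by apply: eq_bigr => y _; ring.
Qed.

Lemma conv_mixr a f g h : conv h (mix a f g) = mix a (conv h f) (conv h g).
Proof. by rewrite convC conv_mixl !(convC h). Qed.

(** Concavity is applied to the left factor, then to the right factor against f only, which isolates
    the entropy of [conv f f]. *)
Lemma ent_conv_mix a f g : 0 <= a <= 1 -> prob f -> prob g ->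
  a * (a * ent (conv f f) + (1 - a) * ent (conv f g)) +
  (1 - a) * ent (conv g (mix a f g)) <= ent (conv (mix a f g) (mix a f g)).
Proof.
move=> a01 fP gP; have mP := mix_prob a01 fP gP; have /andP[a0 a1] := a01.
rewrite [in leRHS]conv_mixl.
apply: le_trans (ent_mix_ge a01 (conv_prob fP mP) (conv_prob gP mP)).
rewrite lerD2r; apply: ler_wpM2l => //; rewrite conv_mixr.
exact: ent_mix_ge a01 (conv_prob fP fP) (conv_prob fP gP).
Qed.

Lemma ent_ge_bound f c : prob f -> (forall x, f x <= c) -> - ln c <= ent f.
Proof.
move=> [f0 f1] fc; rewrite /ent lerN2 -[leRHS]mul1r -f1 mulr_suml.
apply: ler_sum => x _; have := f0 x; rewrite le_eqVlt => /orP[/eqP <-|fx].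
  by rewrite !mul0r.
by rewrite ler_pM2l // ler_ln ?posrE // (lt_le_trans fx).
Qed.

(** The conditional law of f given A. *)
Definition restr f (A : {set 'F_p}) x : R := f x * (x \in A)%:R / \sum_(y in A) f y.

Lemma restr_prob f (A : {set 'F_p}) : prob f -> 0 < \sum_(y in A) f y -> prob (restr f A).
Proof.
move=> [f0 f1] A0; split.
  by move=> x; rewrite divr_ge0 ?mulr_ge0 // ltW.
rewrite -mulr_suml (_ : \sum_x _ = \sum_(y in A) f y) ?divff ?gt_eqF //.
by rewrite [RHS]big_mkcond; apply: eq_bigr => x _; case: (x \in A); rewrite ?mulr1 ?mulr0.
Qed.

Lemma sum_setC f (A : {set 'F_p}) : prob f ->
  \sum_(y in ~: A) f y = 1 - \sum_(y in A) f y.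
Proof.
move=> [_ f1].
have : \sum_x f x = \sum_(y in A) f y + \sum_(y in ~: A) f y.
  rewrite (bigID (fun y => y \in A)) /=; congr (_ + _).
  by apply: eq_bigl => y; rewrite inE.
by rewrite f1; lra.
Qed.

Lemma restr_mix f (A : {set 'F_p}) : prob f -> 0 < \sum_(y in A) f y < 1 ->
  f = mix (\sum_(y in A) f y) (restr f A) (restr f (~: A)).
Proof.
move=> fP /andP[A0 A1]; apply/funext => x; rewrite /mix /restr.
have B0 : 0 < \sum_(y in ~: A) f y by rewrite sum_setC // subr_gt0.
rewrite -sum_setC // ![_ * (_ / _)]mulrC !divfK ?gt_eqF //.
by rewrite inE; case: (x \in A); rewrite /= ?mulr1 ?mulr0 ?addr0 ?add0r.
Qed.

End Mixture.

(** * Entropy gain for laws with a large atom and for spread laws *)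

Section Gain.
Variables (R : realType) (p : nat).
Hypothesis p_pr : prime p.
Implicit Types f : 'F_p -> R.

Lemma ln2_le1 : ln 2 <= 1 :> R.
Proof. by have := @ln_le_subr1 R 2; lra. Qed.

Lemma ent_delta x0 : ent (fun x : 'F_p => (x == x0)%:R : R) = 0.
Proof.
rewrite /ent big1 ?oppr0 // => x _; case: (x == x0); rewrite ?mul0r //.
by rewrite ln1 mulr0.
Qed.

(** Write f = (1 - b) nu + b delta with b = f x0. Concavity bounds the entropy of [conv f f] below
    by (1 - b) ent nu + b ent f, while ent f is at most (1 - b) ent nu plus a binary entropy, itself
    at most 1. *)
Lemma gain_atom f x0 : prob f -> f x0 * ent f - 1 <= ent (conv f f) - ent f.
Proof.
move=> fP; have [f0 f1] := fP; set b := f x0.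
have S1 : \sum_(y in [set x0]) f y = b by rewrite big_set1.
have S2 : \sum_(y in ~: [set x0]) f y = 1 - b by rewrite sum_setC // S1.
have b1 : b <= 1 by rewrite -subr_ge0 -S2 sumr_ge0.
have gain0 : ent f <= ent (conv f f) by apply: ent_conv_ge_r.
have ent_le : b * ent f <= 1 -> b * ent f - 1 <= ent (conv f f) - ent f by lra.
have := f0 x0; rewrite -/b le_eqVlt => /orP[/eqP b0|b0].
  by apply: ent_le; rewrite -b0 mul0r.
move: b1; rewrite le_eqVlt => /orP[/eqP b1|b1].
  apply: ent_le; rewrite b1 mul1r (_ : f = fun x => (x == x0)%:R) ?ent_delta //.
  apply/funext => x; have [->|xx] := eqVneq x x0; first by rewrite -/b b1.
  have : f x <= \sum_(y in ~: [set x0]) f y.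
    by rewrite (bigD1 x) ?inE //= lerDl sumr_ge0.
  by rewrite S2 b1 subrr => fx; apply/eqP; rewrite eq_le fx f0.
have b01 : 0 < 1 - b < 1 by rewrite subr_gt0 b1 /=; lra.
have b01' : 0 <= 1 - b <= 1 by lra.
set nu := restr f (~: [set x0]).
have nuP : prob nu by apply: restr_prob; rewrite // S2 subr_gt0.
pose de (x : 'F_p) : R := (x == x0)%:R.
have deE : de = restr f (~: ~: [set x0]).
  apply/funext => x; rewrite /de /restr finset.setCK S1 inE.
  by have [->|_] := eqVneq x x0; rewrite ?mulr0 ?mul0r // mulr1 divff // gt_eqF.
have deP : prob de by rewrite deE finset.setCK; apply: restr_prob; rewrite // S1.
have fE : f = mix (1 - b) nu de by rewrite deE -S2; apply: restr_mix; rewrite ?S2.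
have U := ent_mix_le b01 nuP deP; rewrite -fE ent_delta in U.
have L := ent_conv_mix b01' nuP deP; rewrite -fE in L.
have h1 := ent_conv_ge_r nuP nuP; have h2 := ent_conv_ge_l nuP deP.
have h3 := ent_conv_ge_r deP fP.
have c1 := @xlnx_ge R (1 - b) ltac:(lra); have c2 := @xlnx_ge R b (ltW b0).
rewrite (_ : 1 - (1 - b) = b) in U L; last by lra.
have k1 : (1 - b) * ent nu <= (1 - b) * ent (conv nu nu) by rewrite ler_wpM2l //; lra.
have k2 : b * ent nu <= b * ent (conv nu de) by rewrite ler_wpM2l // ltW.
have k3 : b * ent f <= b * ent (conv de f) by rewrite ler_wpM2l // ltW.
have k4 : (1 - b) * ((1 - b) * ent nu + b * ent nu) <=
   (1 - b) * ((1 - b) * ent (conv nu nu) + b * ent (conv nu de)).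
  by apply: ler_wpM2l; lra.
have k5 : (1 - b) * ((1 - b) * ent nu + b * ent nu) = (1 - b) * ent nu by ring.
lra.
Qed.

(** Tangent line of x ln x at exp (- M), with its nonnegative term b dropped. *)
Lemma xlnx_ge_exp (b M : R) : 0 <= b -> - (b * M) - expR (- M) <= b * ln b.
Proof.
rewrite le_eqVlt => /orP[/eqP <-|b0]; first by rewrite !mul0r; have := expR_ge0 (- M); lra.
have u0 : 0 <= b * expR M by rewrite mulr_ge0 ?expR_ge0 // ltW.
have := xlnx_ge u0; rewrite lnM ?posrE ?expR_gt0 // expRK => h.
have e : expR M * expR (- M) = 1 by exact: expRxMexpNx_1.
have := ler_wpM2l (expR_ge0 (- M)) h.
have -> : expR (- M) * (b * expR M - 1) = b * (expR M * expR (- M)) - expR (- M) by ring.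
have -> : expR (- M) * (b * expR M * (ln b + M)) =
  b * (expR M * expR (- M)) * (ln b + M) by ring.
by rewrite e; lra.
Qed.

(* Cut f at its h = p / 2 largest values: f = a nu1 + (1 - a) nu2, where nu1 has
   small support and nu2 is bounded by 3 / (p (1 - a)). *)
Lemma gain_spread f d K M : prob f -> (forall x, f x <= d) -> (3 < p)%N ->
  ent f <= ln p%:R - K -> 4 + 2 * M <= K ->
  ln 2 / 2 - 18 * d - 2 * expR (- M) <= ent (conv f f) - ent f.
Proof.
move=> fP fd p3 entK MK; have [f0 f1] := fP; have cT : #|'F_p| = p := card_Fp p_pr.
have d0 : 0 <= d := le_trans (f0 0) (fd 0).
have [h [hp h3 h2]] : exists h, [/\ (2 * h <= p)%N, (p <= 3 * h)%N & (h <= p)%N].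
  by exists p./2; split; lia.
have h0 : 0 < h%:R :> R by rewrite ltr0n; lia.
pose A := top f h; have cA : #|A| = h by rewrite card_top ?cT.
pose a := \sum_(y in A) f y; have aE : \sum_(j < h) dec f j = a by rewrite sum_top ?cT.
have eM := expR_ge0 (- M).
have bE : \sum_(y in ~: A) f y = 1 - a by apply: sum_setC.
pose c := dec f h.
have fc x : x \in ~: A -> f x <= c.
  rewrite inE mem_top -leqNgt => hx; rewrite -(dec_index f x).
  exact: noninc_leq (dec_noninc f0) hx.
have c0 : 0 <= c by apply: dec_ge0.
have ca : h%:R * c <= a.
  rewrite -aE mulr_natl -[X in _ *+ X]card_ord -sumr_const; apply: ler_sum => j _.
  exact: noninc_leq (dec_noninc f0) (ltnW (ltn_ord j)).
have ph : p%:R <= 3 * h%:R :> R by rewrite -natrM ler_nat; lia.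
(* At most 2 h points lie outside A, with values at most c, and the h points of A have values at
   least c. Hence a >= 1 / 3, so that nu1 <= 3 d and the loss 6 d becomes 18 d. *)
have b2a : 1 - a <= 2 * a.
  rewrite -bE; apply: (@le_trans _ _ (\sum_(y in ~: A) c)); first exact: ler_sum.
  rewrite sumr_const -mulr_natl.
  have -> : #|~: A| = (p - h)%N by rewrite cardsCs finset.setCK cA cT.
  have : (p - h)%:R <= 2 * h%:R :> R by rewrite -natrM ler_nat; lia.
  by move=> /(ler_wpM2r c0); lra.
have a1 : a <= 1 by rewrite -subr_ge0 -bE sumr_ge0.
have small g : (forall x, x \notin A -> g x = 0) ->
    (2 * #|[set x | g x != 0%R :> R]%SET| <= p)%N.
  move=> gA; apply: leq_trans hp.
  rewrite leq_mul2l -cA subset_leq_card //; apply/fintype.subsetP => x; rewrite inE.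
  by apply: contraR => /gA ->.
move: a1; rewrite le_eqVlt => /orP[/eqP a1|a1].
  have fA x : x \notin A -> f x = 0.
    move=> xA; have : f x <= \sum_(y in ~: A) f y.
      have xB : x \in ~: A by rewrite finset.inE.
      by rewrite (bigD1 x xB) /= lerDl sumr_ge0.
    by rewrite bE a1 subrr => fx; apply/eqP; rewrite eq_le fx f0.
  have := ent_conv_small_support p_pr f0 f1 fd (small _ fA); lra.
pose b := 1 - a.
have b0 : 0 < b by rewrite subr_gt0.
have a0 : 0 < a by rewrite /b in b0; lra.
have aint : 0 < a < 1 by rewrite a0 a1.
have aint' : 0 <= a <= 1 by rewrite !ltW.
pose nu1 := restr f A; pose nu2 := restr f (~: A).
have nu1P : prob nu1 by apply: restr_prob.
have nu2P : prob nu2 by apply: restr_prob; rewrite // bE.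
have fE : f = mix a nu1 nu2 by apply: restr_mix.
have g1 : ent nu1 + ln 2 / 2 - 18 * d <= ent (conv nu1 nu1).
  have nu1d x : nu1 x <= 3 * d.
    rewrite /nu1 /restr ler_pdivrMr // -/a.
    apply: (@le_trans _ _ d); last by nra.
    by case: (x \in A); rewrite ?mulr1 ?mulr0.
  have supp : (2 * #|[set x | nu1 x != 0%R]%SET| <= p)%N.
    by apply: small => x xA; rewrite /nu1 /restr (negPf xA) mulr0 mul0r.
  by have := ent_conv_small_support p_pr nu1P.1 nu1P.2 nu1d supp; lra.
have H2 : ln p%:R - ln 3 + ln b <= ent nu2.
  have pR : 0 < p%:R :> R by rewrite ltr0n prime_gt0.
  have nu2c x : nu2 x <= 3 / p%:R / b.
    rewrite /nu2 /restr bE -/b ler_pM2r ?invr_gt0 //.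
    apply: (@le_trans _ _ c).
      by have := fc x; case: (x \in ~: A); rewrite ?mulr1 ?mulr0 // => /(_ isT).
    rewrite ler_pdivlMr //.
    apply: (@le_trans _ _ (c * (3 * h%:R))); first by rewrite ler_wpM2l.
    by lra.
  have := ent_ge_bound nu2P nu2c.
  by rewrite ln_div ?posrE ?divr_gt0 // ln_div ?posrE //; lra.
have ln3 : ln 3 <= 2 :> R by have := @ln_le_subr1 R 3; lra.
have U := ent_mix_le aint nu1P nu2P; rewrite -fE -/b in U.
have G := ent_mix_ge aint' nu1P nu2P; rewrite -fE -/b in G.
have L := ent_conv_mix aint' nu1P nu2P; rewrite -fE -/b in L.
have k1 := ent_conv_ge_r nu1P nu2P; have k2 := ent_conv_ge_l nu2P fP.
have X1 := @xlnx_ge R a (ltW a0); have X2 := xlnx_ge_exp M (ltW b0).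
have ab : a = 1 - b by rewrite /b; lra.
(* The entropy of nu2 is close to ln p by [H2], whereas that of f is at least K below; by concavity
   nu1 must fall short of nu2. *)
have gap : K - ln 3 + ln b <= a * (ent nu2 - ent nu1).
  rewrite ab; rewrite ab in G; lra.
have gapb : b * (K - ln 3 + ln b) <= b * (a * (ent nu2 - ent nu1)).
  by rewrite ler_wpM2l // ltW.
set g := ln 2 / 2 - 18 * d.
have {}g1 : ent nu1 + g <= ent (conv nu1 nu1) by rewrite addrA.
(* Subtracting [U], the gain is at least a^2 g + a b (ent nu2 - ent nu1) + a ln a + b ln b. In 4 + 2
   M, the 4 pays b for replacing a^2 g by g, b for a ln a and 2 b for ln 3; the 2 M pays for two
   copies of b ln b. *)
have m1 : a * (a * (ent nu1 + g) + b * ent nu2) + b * ent nu2 <= ent (conv f f).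
  apply: le_trans L; apply: lerD; last by apply: ler_wpM2l => //; apply: ltW.
  apply: ler_wpM2l; first exact: ltW.
  by apply: lerD; apply: ler_wpM2l => //; apply: ltW.
have l2 := ln2_le1.
have gle : g <= 1 / 2 by rewrite /g; lra.
have ag : g - b <= a * (a * g).
  rewrite ab; have b2 : 0 <= 2 - b by rewrite /b; lra.
  have g2 : 0 <= 1 / 2 - g by lra.
  have := mulr_ge0 (ltW b0) (mulr_ge0 b2 g2); have := mulr_ge0 (ltW b0) (ltW b0); lra.
have bK : b * (4 + 2 * M) <= b * K by rewrite ler_wpM2l // ltW.
have bl3 : b * ln 3 <= b * 2 by rewrite ler_wpM2l // ltW.
rewrite ab in m1 U gapb ag X1; lra.
Qed.

End Gain.

(** * The law of a random variable *)

Local Open Scope classical_set_scope.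
Local Open Scope ring_scope.

Section Law.
Context {R : realType} {p : nat} {d : measure_display} {Omega : measurableType d}
  {P : probability Omega R}.

Lemma measurable_Fp (A : set 'F_p) : measurable A.
Proof. by []. Qed.

Lemma measurable_preimage (X : {RV P >-> 'F_p}) (A : set 'F_p) : measurable (X @^-1` A).
Proof.
by rewrite -[X in measurable X]setTI; apply: measurable_funP => //; apply: measurable_Fp.
Qed.

Lemma measure_split (X : {RV P >-> 'F_p}) (B : set Omega) : measurable B ->
  fine (P B) = \sum_(x : 'F_p) fine (P (B `&` X @^-1` [set x])).
Proof.
move=> mB; have mBx x : measurable (B `&` X @^-1` [set x]).
  by apply: measurableI => //; apply: measurable_preimage.
have BE : B = \big[setU/set0]_(x in 'F_p) (B `&` X @^-1` [set x]).
  rewrite -bigcup_pred; apply/seteqP; split => [w Bw|w [x _ []]] //.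
  by exists (X w).
rewrite sum_fine => [|x _]; last exact: fin_num_measure.
rewrite {1}BE measure_bigsetU_ord //.
by apply/trivIsetP => x y _ _ xy; apply/seteqP; split => // w [[_ /= xE] [_ /= yE]];
  rewrite -xE -yE eqxx in xy.
Qed.

Lemma Pr_ge0 (X : {RV P >-> 'F_p}) x : 0 <= Pr P X x.
Proof. exact/fine_ge0/measure_ge0. Qed.

Lemma prob_Pr (X : {RV P >-> 'F_p}) : prob (Pr P X).
Proof.
split; first exact: Pr_ge0.
have := measure_split X measurableT; rewrite probability_setT /= => ->.
by apply: eq_bigr => x _; rewrite setTI.
Qed.

Lemma Pr_add (X X' : {RV P >-> 'F_p}) : independent_copy X X' ->
  Pr P (fun w => X w + X' w) = conv (Pr P X) (Pr P X).
Proof.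
move=> [ind same]; apply/funext => z.
have mz : measurable ((fun w => X w + X' w) @^-1` [set z]).
  rewrite (_ : _ @^-1` _ = \big[setU/set0]_(x in 'F_p)
     (X @^-1` [set x] `&` X' @^-1` [set z - x])).
    apply: bigsetU_measurable => x _.
    by apply: measurableI; apply: measurable_preimage.
  rewrite -bigcup_pred; apply/seteqP; split => [w /= <-|w [x _ [/= -> ->]]].
    by exists (X w) => //; split => //=; rewrite addrC addKr.
  by rewrite addrC subrK.
rewrite /Pr (measure_split X mz); apply: eq_bigr => y _.
have -> : (fun w => X w + X' w) @^-1` [set z] `&` X @^-1` [set y] =
    X @^-1` [set y] `&` X' @^-1` [set z - y].
  apply/seteqP; split => w /= [].
    by move=> <- ->; split => //; rewrite addrC addKr.
  by move=> -> ->; rewrite addrC subrK.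
rewrite ind; [|exact: measurable_Fp..].
rewrite fineM ?fin_num_measure //; try exact: measurable_preimage.
congr (_ * fine _); have := same [set z - y] (measurable_Fp _).
by rewrite /distribution /pushforward => ->.
Qed.

Lemma entropy_ent (X : Omega -> 'F_p) : entropy P X = ent (Pr P X) / ln 2.
Proof.
rewrite /entropy /ent mulNr mulr_suml; congr (- _); apply: eq_bigr => x _.
by rewrite /log2 mulrA.
Qed.

End Law.

(** * Choice of the constants and passage from nats to bits *)

Theorem theorem1p1 (R : realType) (eps : R) (heps0 : 0 < eps)
    (heps1 : eps < 1 / 2) :
  exists k K : R,
    forall p : nat, prime p -> k + K < log2 (p%:R : R) ->
    forall (d : measure_display) (Omega : measurableType d)
      (P : probability Omega R) (X X' : {RV P >-> 'F_p}),
    k < entropy P X -> entropy P X < log2 (p%:R : R) - K ->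
    independent_copy X X' ->
    entropy P (fun w => X w + X' w) >= entropy P X + 1 / 2 - eps.
Proof.
have l2 : 0 < ln 2 :> R by rewrite ln_gt0 // ltr1n.
have l21 := ln2_le1 R.
pose E := eps * ln 2; have E0 : 0 < E by rewrite mulr_gt0.
(* The two losses in [gain_spread] are E / 2 each: 2 exp (- M) here, and 18 c for the c below. *)
pose M := ln (4 / E); have M0 : 0 <= M.
  rewrite ln_ge0 // ler_pdivlMr // mul1r /E; nra.
pose c := E / 36; have c0 : 0 < c by rewrite divr_gt0.
(* If ent f >= 2 / c, an atom above c gives a gain of at least 1 by [gain_atom]; the extra 2 forces
   p > 3; the second constant is the distance from ln p required by [gain_spread], in bits. *)
exists (2 / c / ln 2 + 2), ((4 + 2 * M) / ln 2) => p p_pr pbig d Omega P X X' Hlo Hhi copy.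
have K0 : 0 <= (4 + 2 * M) / ln 2 by rewrite divr_ge0 // ltW //; lra.
have k0 : 0 <= 2 / c / ln 2 by rewrite !divr_ge0 // ltW.
have pR : 0 < p%:R :> R by rewrite ltr0n prime_gt0.
have p3 : (3 < p)%N.
  have : 2 < log2 (p%:R : R) by lra.
  rewrite /log2 ltr_pdivlMr // mulr_natl -lnXn // ltr_ln ?posrE ?exprn_gt0 //.
  by rewrite -natrX ltr_nat => /ltnW.
pose f := Pr P X; have fP : prob f := prob_Pr X.
rewrite entropy_ent -/f in Hlo Hhi; rewrite !entropy_ent (Pr_add copy) -/f.
have gain : ln 2 / 2 - E <= ent (conv f f) - ent f.
  have [[x fx]|small] := pselect (exists x, c < f x).
    have entf : 2 / c <= ent f.
      by rewrite -(ler_pM2r (_ : 0 < (ln 2)^-1)) ?invr_gt0 //; lra.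
    have := gain_atom x fP.
    have c2 : c * (2 / c) = 2 by rewrite mulrC divfK // gt_eqF.
    have : c * (2 / c) <= f x * ent f.
      apply: ler_pM => //; [exact: ltW|by rewrite divr_ge0 // ltW|exact: ltW].
    by rewrite c2; lra.
  have fc x : f x <= c by rewrite leNgt; apply/negP => fx; apply: small; exists x.
  have Hhi' : ent f <= ln p%:R - (4 + 2 * M).
    by move: Hhi; rewrite /log2 -mulrBl ltr_pM2r ?invr_gt0 // => /ltW.
  have := gain_spread p_pr fP fc p3 Hhi' (lexx _).
  rewrite expRN /M lnK ?posrE ?divr_gt0 // invf_div /c; lra.
rewrite ler_pdivlMr // mulrBl mulrDl divfK ?gt_eqF //.
by move: gain; rewrite /E; lra.
Qed.
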